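(* Let $K$ be a field of characteristic $p>0$. 1. For each real number $d$ from the interval $[n,2n]$ there exists a cyclic $\mathcal D(P_n)$-module $M$ such that $\mathrm{Dim}(M)=d$. 2. The dimension $\mathrm{Dim}(N)$ of a nonzero finitely presented $\mathcal D(P_n)$-module $N$ can be any natural number from the interval $[n,2n]$.
   Context: $P_n=K[x_1,\dots,x_n]$, $n\ge1$; $\mathcal D(P_n)$ is the ring of $K$-linear differential operators on $P_n$. For $k\ge0$ let $\partial_i^{[k]}=\frac{\partial_i^k}{k!}$ be the $K$-linear operator $x^\alpha\mapsto\binom{\alpha_i}{k}x^{\alpha-ke_i}$ (zero if $k>\alpha_i$, where $e_i$ is the $i$-th unit vector), and $\partial^{[\beta]}=\prod_i\partial_i^{[\beta_i]}$ for $\beta\in\mathbb N^n$. Then $\mathcal D(P_n)=\bigoplus_{\alpha,\beta\in\mathbb N^n}Kx^\alpha\partial^{[\beta]}$. The canonical filtration is $F=\{F_i\}_{i\ge 0}$, $F_i=\bigoplus_{|\alpha|+|\beta|\le i}Kx^\alpha\partial^{[\beta]}$. Modules are left modules. For $f:\mathbb N\to\mathbb N$, $\gamma(f):=\inf\{r\in\mathbb R: f(i)\le i^r\text{ for }i\gg0\}$. For a finitely generated module $M=\mathcal D(P_n)M_0$ with $\dim_KM_0<\infty$, $\mathrm{Dim}(M):=\gamma(i\mapsto\dim_K F_iM_0)$; this is independent of the choice of the finite dimensional generating subspace $M_0$. *)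

(* Defs.v *)
From HB Require Import structures.
From mathcomp Require Import all_boot all_order all_algebra.
From mathcomp Require Import ssrcomplements mpoly.
From mathcomp Require Import boolp classical_sets reals ereal topology.
From mathcomp Require Import exp.

Set Implicit Arguments.
Unset Strict Implicit.
Unset Printing Implicit Defensive.

Import Order.TTheory GRing.Theory Num.Theory.

Local Open Scope ring_scope.
Local Open Scope classical_set_scope.

Section DiffopLt.
Variables (K : fieldType) (n : nat).
Local Notation P := {mpoly K[n]}.
Implicit Types (f g : P -> P) (a : P).

Definition comm_op f a : P -> P := fun q => f (a * q) - a * f q.

(* Grothendieck's definition, with the order shifted by one: [diffop_lt k f]
   says that f has order < k, so that the base case is the zero operator. *)
Fixpoint diffop_lt (k : nat) f : Prop :=
  if k is k'.+1 then forall a, diffop_lt k' (comm_op f a)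
  else forall q, f q = 0.

Lemma diffop_lt_ext k f g : f =1 g -> diffop_lt k f -> diffop_lt k g.
Proof. by move=> /funext ->. Qed.

Lemma diffop_lt0 k : diffop_lt k (fun=> 0).
Proof.
elim: k => [//|k IH] a /=; apply: diffop_lt_ext IH => q.
by rewrite /comm_op mulr0 subr0.
Qed.

Lemma diffop_ltS k f : diffop_lt k f -> diffop_lt k.+1 f.
Proof.
elim: k f => [|k IH] f fk a; last exact/IH/fk.
by move=> q; rewrite /comm_op !fk mulr0 subr0.
Qed.

Lemma diffop_ltW k l f : (k <= l)%N -> diffop_lt k f -> diffop_lt l f.
Proof.
move=> /subnK <- fk; elim: (l - k)%N => // m IH.
by rewrite addSn; apply: diffop_ltS.
Qed.

Lemma diffop_ltD k f g :
  diffop_lt k f -> diffop_lt k g -> diffop_lt k (fun q => f q + g q).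
Proof.
elim: k f g => [|k IH] f g fk gk; first by move=> q; rewrite fk gk addr0.
move=> a; apply: diffop_lt_ext (IH _ _ (fk a) (gk a)) => q.
by rewrite /comm_op mulrDr opprD addrACA.
Qed.

Lemma diffop_ltZ k (c : K) f : diffop_lt k f -> diffop_lt k (fun q => c *: f q).
Proof.
elim: k f => [|k IH] f fk; first by move=> q; rewrite fk scaler0.
move=> a; apply: diffop_lt_ext (IH _ (fk a)) => q.
by rewrite /comm_op scalerBr scalerAr.
Qed.

Lemma comm_op_linear f a : linear f -> linear (comm_op f a).
Proof.
move=> fL c x y; rewrite /comm_op mulrDr -scalerAr !fL mulrDr -scalerAr.
by rewrite scalerBr opprD addrACA.
Qed.

Lemma diffop_lt_comp k l f g : linear f ->
  diffop_lt k f -> diffop_lt l g -> diffop_lt (k + l) (f \o g).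
Proof.
move: {2}(k + l)%N (leqnn (k + l)) => m.
elim: m k l f g => [|m IH] [|k] l f g //= klm fL fk gl.
- by apply: diffop_lt_ext (diffop_lt0 _) => q; rewrite /= fk.
- by apply: diffop_lt_ext (diffop_lt0 _) => q; rewrite /= fk.
have f0 : f 0 = 0.
  by move: (fL (-1) 0 0); rewrite scaler0 addr0 scaleN1r addNr.
case: l gl klm => [|l] gl klm.
  apply: (@diffop_lt_ext (k + 0).+1 (fun=> 0)); last exact: diffop_lt0.
  by move=> q /=; rewrite gl f0.
move=> a.
apply: (@diffop_lt_ext _ (fun q => (f \o comm_op g a) q + (comm_op f a \o g) q)).
  move=> q; rewrite /comm_op /=.
  have -> : f (g (a * q) - a * g q) = f (g (a * q)) - f (a * g q).
    by rewrite addrC -scaleN1r fL scaleN1r addrC.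
  by rewrite addrA subrK.
apply: diffop_ltD; last first.
  by apply: (IH k l.+1) => //; exact: comm_op_linear.
by rewrite addnS -addSn; apply: (IH k.+1 l) => //; rewrite addSn -addnS.
Qed.

Lemma diffop_lt_mulop (p : P) : diffop_lt 1 ( *%R p).
Proof. by move=> a q; rewrite /comm_op mulrCA subrr. Qed.

Lemma diffop_lt_gen k f : linear f ->
  (forall i : 'I_n, diffop_lt k (comm_op f 'X_i)) -> diffop_lt k.+1 f.
Proof.
move=> fL fX /=; have f0 : f 0 = 0.
  by move: (fL (-1) 0 0); rewrite scaler0 addr0 scaleN1r addNr.
have fD x y : f (x + y) = f x + f y by rewrite -[x]scale1r fL !scale1r.
have fZ c x : f (c *: x) = c *: f x by rewrite -[c *: x]addr0 fL f0 addr0.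
have mulL (a : P) : linear ( *%R a) by move=> c x y; rewrite mulrDr scalerAr.
have mullr h a : linear h -> diffop_lt k h -> diffop_lt k (fun q => h (a * q)).
  move=> hL hk; case: k hk {fX} => [|k'] hk; first by move=> q; exact: hk.
  move=> b; apply: (@diffop_lt_ext k' (fun q => comm_op h b (a * q))) => [q|].
    by rewrite /comm_op mulrCA.
  elim: k' h b hL hk a => [|k' IH] h b hL hk a; first by move=> q; exact: hk.
  move=> c; apply: diffop_lt_ext (IH (comm_op h b) c _ (hk b) a) => [q|].
    by rewrite /comm_op; congr (_ - _); rewrite ![a * (_ * q)]mulrCA.
  exact: comm_op_linear.
have mulll h a : diffop_lt k h -> diffop_lt k (fun q => a * h q).
  elim: k h {fX mullr} => [|k' IH] h hk; first by move=> q; rewrite hk mulr0.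
  move=> b; apply: diffop_lt_ext (IH _ (hk b)) => q.
  by rewrite /comm_op mulrBr [b * (a * _)]mulrCA.
have fM a b : diffop_lt k (comm_op f a) -> diffop_lt k (comm_op f b) ->
    diffop_lt k (comm_op f (a * b)).
  move=> fa fb; apply: diffop_lt_ext
    (diffop_ltD (mullr _ b (comm_op_linear a fL) fa) (mulll _ a fb)) => q.
  by rewrite /comm_op mulrBr !mulrA addrA subrK.
have f1 : diffop_lt k (comm_op f 1).
  by apply: diffop_lt_ext (diffop_lt0 _) => q; rewrite /comm_op !mul1r subrr.
have fXm m : diffop_lt k (comm_op f 'X_[m]).
  rewrite mpolyXE_id; elim/big_ind: _ => // i _.
  by elim: (m i) => [|e IH]; rewrite ?expr0 ?exprS //; apply: fM.
elim/mpolyind => [|c m p _ _ IH].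
  by apply: diffop_lt_ext (diffop_lt0 _) => q; rewrite /comm_op !mul0r f0 subr0.
apply: diffop_lt_ext (diffop_ltD (diffop_ltZ c (fXm m)) IH) => q.
by rewrite /comm_op !mulrDl fD -!scalerAl fZ scalerBr opprD addrACA.
Qed.

End DiffopLt.

Record diffop (K : fieldType) (n : nat) := DiffOp {
  diffop_fun :> {mpoly K[n]} -> {mpoly K[n]};
  diffop_linear : linear diffop_fun;
  diffop_order : exists k, diffop_lt k diffop_fun }.

HB.instance Definition _ (K : fieldType) (n : nat) (D : diffop K n) :=
  GRing.isLinear.Build K {mpoly K[n]} {mpoly K[n]} *:%R D (diffop_linear D).
HB.instance Definition _ (K : fieldType) (n : nat) := gen_eqMixin (diffop K n).
HB.instance Definition _ (K : fieldType) (n : nat) :=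
  gen_choiceMixin (diffop K n).

Section DiffopAlgebra.
Variables (K : fieldType) (n : nat).
Local Notation P := {mpoly K[n]}.
Local Notation D := (diffop K n).
Implicit Types (u v w : D) (c : K).

Lemma diffopP u v : u =1 v -> u = v.
Proof.
case: u v => [f fL fo] [g gL go] /= /funext fg; case: _ / fg in gL go *.
by congr DiffOp; exact: Prop_irrelevance.
Qed.

Fact diffop_zero_linear : linear (fun _ : P => 0 : P).
Proof. by move=> c x y; rewrite scaler0 addr0. Qed.
Fact diffop_zero_order : exists k, diffop_lt k (fun _ : P => 0 : P).
Proof. by exists 0. Qed.
Definition diffop_zero := DiffOp diffop_zero_linear diffop_zero_order.

Fact diffop_add_linear u v : linear (fun q => u q + v q).
Proof. by move=> c x y; rewrite !linearP scalerDr addrACA. Qed.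
Fact diffop_add_order u v : exists k, diffop_lt k (fun q => u q + v q).
Proof.
have [[k uk] [l vl]] := (diffop_order u, diffop_order v).
exists (maxn k l); apply: diffop_ltD.
- exact: diffop_ltW (leq_maxl _ _) uk.
- exact: diffop_ltW (leq_maxr _ _) vl.
Qed.
Definition diffop_add u v := DiffOp (diffop_add_linear u v) (diffop_add_order u v).

Fact diffop_scale_linear c u : linear (fun q => c *: u q).
Proof. by move=> d x y; rewrite linearP scalerDr !scalerA mulrC. Qed.
Fact diffop_scale_order c u : exists k, diffop_lt k (fun q => c *: u q).
Proof. by have [k uk] := diffop_order u; exists k; exact: diffop_ltZ. Qed.
Definition diffop_scale c u :=
  DiffOp (diffop_scale_linear c u) (diffop_scale_order c u).

Fact diffop_mulop_linear (p : P) : linear ( *%R p).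
Proof. by move=> c x y; rewrite mulrDr scalerAr. Qed.
Fact diffop_mulop_order (p : P) : exists k, diffop_lt k ( *%R p).
Proof. by exists 1; exact: diffop_lt_mulop. Qed.
Definition mulop (p : P) : D :=
  DiffOp (diffop_mulop_linear p) (diffop_mulop_order p).

Fact diffop_comp_linear u v : linear (u \o v).
Proof. by move=> c x y; rewrite /= !linearP. Qed.
Fact diffop_comp_order u v : exists k, diffop_lt k (u \o v).
Proof.
have [[k uk] [l vl]] := (diffop_order u, diffop_order v).
by exists (k + l)%N; apply: diffop_lt_comp => //; exact: diffop_linear.
Qed.
Definition diffop_comp u v :=
  DiffOp (diffop_comp_linear u v) (diffop_comp_order u v).

Fact diffop_addA : associative diffop_add.
Proof. by move=> u v w; apply/diffopP => q /=; rewrite addrA. Qed.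
Fact diffop_addC : commutative diffop_add.
Proof. by move=> u v; apply/diffopP => q /=; rewrite addrC. Qed.
Fact diffop_add0 : left_id diffop_zero diffop_add.
Proof. by move=> u; apply/diffopP => q /=; rewrite add0r. Qed.
Fact diffop_addN : left_inverse diffop_zero (diffop_scale (-1)) diffop_add.
Proof. by move=> u; apply/diffopP => q /=; rewrite scaleN1r addNr. Qed.

HB.instance Definition _ := GRing.isZmodule.Build D
  diffop_addA diffop_addC diffop_add0 diffop_addN.

Fact diffop_compA : associative diffop_comp.
Proof. by move=> u v w; apply/diffopP. Qed.
Fact diffop_comp1l : left_id (mulop 1) diffop_comp.
Proof. by move=> u; apply/diffopP => q /=; rewrite mul1r. Qed.
Fact diffop_comp1r : right_id (mulop 1) diffop_comp.
Proof. by move=> u; apply/diffopP => q /=; rewrite mul1r. Qed.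
Fact diffop_compDl : left_distributive diffop_comp diffop_add.
Proof. by move=> u v w; apply/diffopP. Qed.
Fact diffop_compDr : right_distributive diffop_comp diffop_add.
Proof. by move=> u v w; apply/diffopP => q /=; rewrite linearD. Qed.
Fact diffop_one_neq0 : mulop 1 != 0 :> D.
Proof.
apply/eqP => /(congr1 (fun u : D => u 1)) /= /eqP.
by rewrite mulr1 oner_eq0.
Qed.

HB.instance Definition _ := GRing.Zmodule_isNzRing.Build D
  diffop_compA diffop_comp1l diffop_comp1r diffop_compDl diffop_compDr
  diffop_one_neq0.

Fact diffop_scaleA c d u :
  diffop_scale c (diffop_scale d u) = diffop_scale (c * d) u.
Proof. by apply/diffopP => q /=; rewrite scalerA. Qed.
Fact diffop_scale1 : left_id 1 diffop_scale.
Proof. by move=> u; apply/diffopP => q /=; rewrite scale1r. Qed.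
Fact diffop_scaleDr : right_distributive diffop_scale +%R.
Proof. by move=> c u v; apply/diffopP => q /=; rewrite scalerDr. Qed.
Fact diffop_scaleDl u : {morph diffop_scale^~ u : c d / c + d}.
Proof. by move=> c d; apply/diffopP => q /=; rewrite scalerDl. Qed.

HB.instance Definition _ := GRing.Zmodule_isLmodule.Build K D
  diffop_scaleA diffop_scale1 diffop_scaleDr diffop_scaleDl.

Fact diffop_scaleAl c u v : c *: (u * v) = (c *: u) * v.
Proof. exact/diffopP. Qed.
HB.instance Definition _ := GRing.Lmodule_isLalgebra.Build K D diffop_scaleAl.

Fact diffop_scaleAr c u v : c *: (u * v) = u * (c *: v).
Proof. by apply/diffopP => q /=; rewrite linearZ. Qed.
HB.instance Definition _ := GRing.Lalgebra_isAlgebra.Build K D diffop_scaleAr.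

End DiffopAlgebra.

Section DividedPowers.
Variables (K : fieldType) (n : nat).
Local Notation P := {mpoly K[n]}.
Local Notation D := (diffop K n).

(* The truncated subtraction of exponents is harmless: the binomial
   coefficient vanishes when k > m i. *)
Definition dpow_fun (i : 'I_n) (k : nat) (q : P) : P :=
  \sum_(m <- msupp q) (q@_m * 'C(m i, k)%:R) *: 'X_[m - U_(i) *+ k].

Lemma dpow_funwE i k d (q : P) : (msize q <= d)%N ->
  dpow_fun i k q = \sum_(m : 'X_{1..n < d})
    (q@_m * 'C(bmnm m i, k)%:R) *: 'X_[m - U_(i) *+ k].
Proof.
pose I := {: 'X_{1..n < d}}.
move=> le_qd; rewrite /dpow_fun (big_mksub I) /=; first last.
- by move=> x /msize_mdeg_lt /leq_trans; apply.
- by rewrite msupp_uniq.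
rewrite big_rmcond //= => j /memN_msupp_eq0 ->.
by rewrite mul0r scale0r.
Qed.

Fact dpow_fun_linear i k : linear (dpow_fun i k).
Proof.
move=> c p q; pose d := maxn (msize (c *: p + q)) (maxn (msize p) (msize q)).
rewrite !(@dpow_funwE i k d) ?leq_max ?leqnn ?orbT //.
rewrite scaler_sumr -big_split /=; apply: eq_bigr => m _.
by rewrite mcoeffD mcoeffZ mulrDl scalerDl -mulrA scalerA.
Qed.

Lemma dpow_funX i k m :
  dpow_fun i k 'X_[m] = 'C(m i, k)%:R *: 'X_[m - U_(i) *+ k].
Proof. by rewrite /dpow_fun msuppX big_seq1 mcoeffX eqxx mul1r. Qed.

Lemma dpow_fun_comm i k (j : 'I_n) (q : P) :
  comm_op (dpow_fun i k) 'X_j q =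
  if (i == j) && (0 < k)%N then dpow_fun i k.-1 q else 0.
Proof.
have L1 := comm_op_linear 'X_j (dpow_fun_linear i k).
have L2 := dpow_fun_linear i k.-1.
have lin0 (f : P -> P) : linear f -> f 0 = 0.
  by move=> fL; move: (fL (-1) 0 0); rewrite scaler0 addr0 scaleN1r addNr.
elim/mpolyind: q => [|c m p _ _ IH].
  by rewrite (lin0 _ L1) (lin0 _ L2) if_same.
rewrite L1 IH L2 /comm_op -mpolyXD !dpow_funX -scalerAr -mpolyXD.
case: eqVneq => [->|ij] /=.
  rewrite mnmDE mnm1E eqxx add1n; case: k {L1 L2 IH} => [|k] /=.
    by rewrite !bin0 !mulm0n !subm0 subrr scaler0 addr0.
  have -> : (U_(j) + m - U_(j) *+ k.+1 = m - U_(j) *+ k)%MM.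
    apply/mnmP => l; rewrite !(mnmBE, mnmDE, mulmnE, mnm1E).
    by case: (j == l); rewrite ?mul1n ?mul0n ?add1n ?subSS.
  rewrite binS natrD scalerDl; case: (leqP k.+1 (m j)) => km; last first.
    by rewrite (bin_small km) !scale0r add0r subr0.
  have -> : (U_(j) + (m - U_(j) *+ k.+1) = m - U_(j) *+ k)%MM.
    apply/mnmP => l; rewrite !(mnmBE, mnmDE, mulmnE, mnm1E).
    case: eqVneq km => [<-|_] km; rewrite ?mul1n ?mul0n ?add1n //.
    by rewrite -subSn // subSS.
  by rewrite addrAC subrr add0r.
rewrite mnmDE mnm1E eq_sym (negPf ij) add0n.
have -> : (U_(j) + m - U_(i) *+ k = U_(j) + (m - U_(i) *+ k))%MM.
  apply/mnmP => l; rewrite !(mnmBE, mnmDE, mulmnE, mnm1E).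
  case: (eqVneq i l) => [il|_]; last by rewrite mul0n !subn0.
  by rewrite -il eq_sym (negPf ij) !add0n.
by rewrite subrr scaler0 addr0.
Qed.

Lemma diffop_lt_dpow i k : diffop_lt k.+1 (dpow_fun i k).
Proof.
elim: k => [|k IH]; apply: diffop_lt_gen; try exact: dpow_fun_linear.
  by move=> j q; rewrite dpow_fun_comm andbF.
move=> j; have -> : comm_op (dpow_fun i k.+1) 'X_j =
    if i == j then dpow_fun i k else fun=> 0.
  by apply/funext => q; rewrite dpow_fun_comm andbT /=; case: eqP.
by case: eqP => _ //; exact: diffop_lt0.
Qed.

Fact dpow_fun_order i k : exists l, diffop_lt l (dpow_fun i k).
Proof. by exists k.+1; exact: diffop_lt_dpow. Qed.

Definition dpow i k : D := DiffOp (dpow_fun_linear i k) (dpow_fun_order i k).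

Definition dpowm (b : 'X_{1..n}) : D := \prod_(i < n) dpow i (b i).

Definition canon_filt (i : nat) : set D :=
  [set u | exists (k : nat) (c : 'I_k -> K) (a b : 'I_k -> 'X_{1..n}),
    (forall j, (mdeg (a j) + mdeg (b j) <= i)%N) /\
    u = \sum_(j < k) c j *: (mulop 'X_[a j] * dpowm (b j))].

End DividedPowers.

Section Dimension.
Variables (K : fieldType) (A : algType K) (M : lmodType A).

(* M is a vector space over K through c |-> c%:A. *)
Definition kspan (k : nat) (v : 'I_k -> M) : set M :=
  [set x | exists c : 'I_k -> K, x = \sum_(j < k) (c j)%:A *: v j].

Definition kfree (k : nat) (v : 'I_k -> M) : Prop :=
  forall c : 'I_k -> K,
    \sum_(j < k) (c j)%:A *: v j = 0 -> forall j, c j = 0.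

Definition has_kdim (V : set M) (k : nat) : Prop :=
  exists v : 'I_k -> M, kfree v /\ V = kspan v.

(* Junk value 0 when V is not a finite dimensional subspace. *)
Definition kdim (V : set M) : nat := xget 0 [set k | has_kdim V k].

Definition prodset (F : set A) (V : set M) : set M :=
  [set x | exists (k : nat) (a : 'I_k -> A) (v : 'I_k -> M),
    (forall j, F (a j) /\ V (v j)) /\ x = \sum_(j < k) a j *: v j].

Definition generating_subspace (V : set M) : Prop :=
  (exists k, has_kdim V k) /\ prodset setT V = setT.

End Dimension.

(* The infimum is taken in the extended reals: gamma f = -oo if f vanishes
   eventually, and gamma f = +oo if f is not polynomially bounded. *)
Definition gamma (R : realType) (f : nat -> nat) : \bar R :=
  ereal_inf [set r%:E | r in
    [set r : R | \forall i \near \oo, (f i)%:R <= i%:R `^ r]].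

(* The value does not depend on the finite dimensional generating subspace
   that xget picks; junk if M is not finitely generated. *)
Definition Dim (R : realType) (K : fieldType) (n : nat)
    (M : lmodType (diffop K n)) : \bar R :=
  let M0 := xget set0 [set V : set M | generating_subspace V] in
  gamma R (fun i => kdim (prodset (@canon_filt K n i) M0)).

Definition cyclic_module (A : nzRingType) (M : lmodType A) : Prop :=
  exists m : M, forall x : M, exists a : A, x = a *: m.

(* An exact sequence A^m -> A^k -> M -> 0 *)
Definition finitely_presented (A : nzRingType) (M : lmodType A) : Prop :=
  exists (m k : nat) (psi : {linear 'rV[A]_m -> 'rV[A]_k})
      (phi : {linear 'rV[A]_k -> M}),
    range psi = [set v | phi v = 0] /\ range phi = setT.

(* Main.v *)
Require Import Defs.
From HB Require Import structures.
From mathcomp Require Import all_boot all_order all_algebra.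
From mathcomp Require Import mpoly.
From mathcomp Require Import boolp classical_sets reals ereal topology.
From mathcomp Require Import exp zify ring lra.

Set Implicit Arguments.
Unset Strict Implicit.
Unset Printing Implicit Defensive.

Import Order.TTheory GRing.Theory Num.Theory.

Local Open Scope ring_scope.

(** Every module below is a cyclic quotient D/I with generator v whose K-basis
    is a set of vectors x^a d^[b] v, so that dim F_i v is a lattice point count.

    For real d = n + t n with 0 <= t <= 1, let T be the set of natural numbers
    whose base p digits vanish outside a set of positions of density t.  Mod p,
    a binomial coefficient C(a, b) with a in T vanishes unless b is in T, so
    the left ideal of the operators killing all the x^a with a in T^n contains
    x^a d^[b] unless b is in T^n, and the remaining x^a d^[b] are independent
    modulo it.  As T has about p^(t k) elements below p^k, the dimension is
    n + t n.

    For the integer 2n - j the ideal is D x_1 + ... + D x_j, and a and b range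
    over the exponents with a_1 = ... = a_j = 0.  Independence holds because an
    operator of order < q = p^k commutes with x_l^q: the ideal element u x_l
    maps x_l^(q-1) f to x_l^q u(f), whereas d_l^[b] maps x_l^(q-1) to
    C(q - 1, b) x_l^(q-1-b), with C(q - 1, b) nonzero in K. *)

(** * Quotients of a ring by a left ideal *)

Section CyclicQuotient.
Variables (A : nzRingType) (I : A -> Prop).
Hypotheses (I0 : I 0) (IB : forall u v, I u -> I v -> I (u - v)).
Hypothesis IM : forall a u, I u -> I (a * u).

Let Ib : {pred A} := fun u => `[< I u >].

Fact left_ideal_zmod_closed : zmod_closed Ib.
Proof.
split; first exact/asboolP.
by move=> u v /asboolP Iu /asboolP Iv; apply/asboolP; exact: IB.
Qed.
HB.instance Definition _ := GRing.isZmodClosed.Build A Ib left_ideal_zmod_closed.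

Definition left_quot : Type := Quotient.quot Ib.
HB.instance Definition _ := GRing.Zmodule.on left_quot.

Let pi_ (a : A) : left_quot := \pi_(Quotient.quot Ib)%qT a.
Let pi_eq a b : pi_ a = pi_ b <-> I (a - b).
Proof.
split=> [/eqP|Iab]; first by rewrite -Quotient.idealrBE => /asboolP.
by apply/eqP; rewrite -Quotient.idealrBE; apply/asboolP.
Qed.
Let piD a b : pi_ (a + b) = pi_ a + pi_ b.
Proof. exact: (Quotient.pi_add Ib). Qed.
Let pi_repr (x : left_quot) : pi_ (repr x) = x.
Proof. exact: reprK. Qed.

Definition left_quot_scale (a : A) (x : left_quot) : left_quot :=
  pi_ (a * repr x).

(** Well defined on classes by [IM]: multiples of elements of the left ideal stay in it, so the
    chosen representative does not matter. *)
Let scale_pi a b : left_quot_scale a (pi_ b) = pi_ (a * b).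
Proof.
by apply/pi_eq; rewrite -mulrBr; apply/IM/pi_eq; rewrite pi_repr.
Qed.

Fact left_quot_scaleA a b x :
  left_quot_scale a (left_quot_scale b x) = left_quot_scale (a * b) x.
Proof. by rewrite -[x]pi_repr !scale_pi mulrA. Qed.
Fact left_quot_scale1 : left_id 1 left_quot_scale.
Proof. by move=> x; rewrite -[x]pi_repr !scale_pi mul1r. Qed.
Fact left_quot_scaleDr : right_distributive left_quot_scale +%R.
Proof.
by move=> a x y; rewrite -[x]pi_repr -[y]pi_repr -piD !scale_pi mulrDr piD.
Qed.
Fact left_quot_scaleDl x : {morph left_quot_scale^~ x : a b / a + b}.
Proof. by move=> a b; rewrite -[x]pi_repr !scale_pi mulrDl piD. Qed.

HB.instance Definition _ := GRing.Zmodule_isLmodule.Build A left_quot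
  left_quot_scaleA left_quot_scale1 left_quot_scaleDr left_quot_scaleDl.

Lemma cyclic_quotient : exists (M : lmodType A) (v : M),
  (forall x : M, exists a : A, x = a *: v) /\
  (forall a : A, a *: v = 0 <-> I a).
Proof.
exists left_quot, (pi_ 1); split=> [x|a].
  by exists (repr x); rewrite [RHS]scale_pi mulr1 pi_repr.
have -> : a *: pi_ 1 = pi_ a by rewrite [LHS]scale_pi mulr1.
have pi0 : 0 = pi_ 0 by exact/esym/(raddf0 (\pi_(Quotient.quot Ib)%qT)).
by rewrite pi0 pi_eq subr0.
Qed.
End CyclicQuotient.

(** * Linear algebra over K inside a module *)

Section VectorSpace.
Local Open Scope classical_set_scope.
Variables (K : fieldType) (A : algType K) (M : lmodType A).
Implicit Types (V : set M).

Lemma kscaleA (c : K) (a : A) (x : M) : c%:A *: (a *: x) = (c *: a) *: x.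
Proof. by rewrite scalerA mulr_algl. Qed.

Lemma kscaleM (c d : K) (x : M) : c%:A *: (d%:A *: x) = (c * d)%:A *: x.
Proof. by rewrite kscaleA scalerA. Qed.

Definition ksubspace V :=
  V 0 /\ forall (c : K) x y, V x -> V y -> V (c%:A *: x + y).

Lemma ksubspaceZ V c x : ksubspace V -> V x -> V (c%:A *: x).
Proof. by move=> [V0 VD] Vx; rewrite -[_ *: _]addr0; exact: VD. Qed.

Lemma ksubspaceD V x y : ksubspace V -> V x -> V y -> V (x + y).
Proof.
by move=> [_ VD] Vx Vy; have := VD 1 x y Vx Vy; rewrite !scale1r.
Qed.

Lemma ksubspace_sum V (I : Type) (r : seq I) (P : pred I) (F : I -> M) :
  ksubspace V -> (forall i, P i -> V (F i)) -> V (\sum_(i <- r | P i) F i).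
Proof.
move=> sV VF; elim/big_ind: _ => //; first by case: sV.
by move=> *; exact: ksubspaceD.
Qed.

Lemma kspan_subspace k (v : 'I_k -> M) : ksubspace (kspan v).
Proof.
split=> [|c _ _ [a ->] [b ->]].
  by exists (fun=> 0); rewrite big1 // => j _; rewrite !scale0r.
exists (fun j => c * a j + b j); rewrite scaler_sumr -big_split /=.
by apply: eq_bigr => j _; rewrite kscaleM -scalerDl -scalerDl.
Qed.

Lemma kspan_mem k (v : 'I_k -> M) j : kspan v (v j).
Proof.
exists (fun i => (i == j)%:R); rewrite (bigD1 j) //= eqxx !scale1r.
by rewrite big1 ?addr0 // => i /negPf ->; rewrite !scale0r.
Qed.

Lemma kspan_sub k (v : 'I_k -> M) V :
  ksubspace V -> (forall j, V (v j)) -> kspan v `<=` V.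
Proof.
by move=> sV Vv _ [c ->]; apply: ksubspace_sum => // j _; exact: ksubspaceZ.
Qed.

(** Steinitz: for k > l the matrix of coordinates has more rows than columns, and a nonzero vector
    of its left kernel is a dependence among the v_j. *)
Lemma kfree_leq k l (v : 'I_k -> M) (w : 'I_l -> M) :
  kfree v -> (forall j, kspan w (v j)) -> (k <= l)%N.
Proof.
move=> vfree /choice[B vE]; pose m := \matrix_(i < k, j < l) B i j.
rewrite leqNgt; apply/negP => ltlk.
have : ~~ row_free m.
  by rewrite /row_free neq_ltn (leq_ltn_trans (rank_leq_col m)).
rewrite -kermx_eq0 => /rowV0Pn[c /sub_kermxP cm /eqP]; apply; apply/rowP => i.
rewrite mxE; apply: (vfree (c 0)).
under eq_bigr => j _ do rewrite vE scaler_sumr.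
rewrite exchange_big /= big1 // => j _.
have := congr1 (fun u : 'rV_l => u 0 j) cm; rewrite !mxE => c0.
transitivity ((\sum_i c 0 i * m i j)%:A *: w j); last by rewrite c0 !scale0r.
rewrite scaler_suml scaler_suml.
by apply: eq_bigr => i' _; rewrite kscaleM mxE.
Qed.

(** A free family in V of maximal length, which exists by [kfree_leq], spans V. *)
Lemma has_kdim_sub V l (w : 'I_l -> M) : ksubspace V -> V `<=` kspan w ->
  exists2 k, (k <= l)%N & has_kdim V k.
Proof.
move=> sV Vw.
pose P k := `[< exists v : 'I_k -> M, kfree v /\ forall j, V (v j) >].
have exP : exists k, P k.
  exists 0; apply/asboolP; exists (fun=> 0).
  by split=> [c _|] [].

have ubP k : P k -> (k <= l)%N.
  by move=> /asboolP[v [vf Vv]]; apply: (kfree_leq vf) => j; exact/Vw/Vv.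
case: (ex_maxnP exP ubP) => k /[dup] /ubP kl /asboolP[v [vf Vv]] kmax.
exists k => //; exists v; split=> //; apply/seteqP; split; last exact: kspan_sub.
move=> x Vx; apply: contrapT => nx.
suff /kmax : P k.+1 by rewrite ltnn.
pose v' (j : 'I_k.+1) := if unlift ord0 j is Some i then v i else x.
apply/asboolP; exists v'; split=> [c|j]; last by rewrite /v'; case: unliftP.
rewrite big_ord_recl {1}/v' unlift_none.
under eq_bigr => i _ do rewrite /v' liftK.
(* A nonzero coefficient of x would express x through the v_j, against [nx]. *)
move=> c0; have c00 : c ord0 = 0.
  apply/eqP; apply: contra_notT nx => c0n.
  exists (fun i => - (c ord0)^-1 * c (lift ord0 i)).
  under eq_bigr => i _ do rewrite -kscaleM.
  rewrite -scaler_sumr; move/eqP: c0; rewrite addr_eq0 => /eqP c0.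
  rewrite scaleNr scaleNr -scalerN -c0 kscaleM mulVf //.
  by rewrite !scale1r.
move: c0; rewrite c00 scale0r scale0r add0r => /vf cl j.
by case: (unliftP ord0 j) => [i ->|->].
Qed.

Lemma kdim_eq V k : has_kdim V k -> kdim V = k.
Proof.
move=> Vk; rewrite /kdim.
have : [set k | has_kdim V k] (xget 0 [set k | has_kdim V k]) by exact: xgetI Vk.
case: Vk => v [vf ->]; set l := xget _ _ => -[w [wf wE]].
apply/eqP; rewrite eqn_leq; apply/andP; split.
  by apply: (kfree_leq (w := v) wf) => j; rewrite wE; exact: kspan_mem.
by apply: (kfree_leq (w := w) vf) => j; rewrite -wE; exact: kspan_mem.
Qed.

Lemma kdim_leq V l (w : 'I_l -> M) :
  ksubspace V -> V `<=` kspan w -> (kdim V <= l)%N.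
Proof. by move=> sV /(has_kdim_sub sV)[k kl /kdim_eq ->]. Qed.

Lemma kdim_geq V k l (w : 'I_l -> M) (v : 'I_k -> M) :
  ksubspace V -> V `<=` kspan w -> kfree v -> (forall j, V (v j)) ->
  (k <= kdim V)%N.
Proof.
move=> sV /(has_kdim_sub sV)[d _ /[dup] /kdim_eq -> [u [_ ->]]] vf Vv.
exact: kfree_leq vf Vv.
Qed.

End VectorSpace.

(** * Exponent induction and a trinomial identity *)

Lemma mnm_ind n (Q : 'X_{1..n} -> Prop) :
  Q 0%MM -> (forall i m, Q m -> Q (U_(i) + m)%MM) -> forall m, Q m.
Proof.
move=> Q0 QS m; have [d] := ubnP (mdeg m); elim: d m => // d IH m md.
have [->//|] := eqVneq m 0%MM; rewrite -mdeg_eq0 mdegE.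
case: (pickP (fun i => m i != 0)%N) => [i mi _|m0]; last first.
  by rewrite big1 // => i _; apply/eqP/negbFE/m0.
have mE : m = (U_(i) + (m - U_(i)))%MM by rewrite addmC submK // lep1mP.
rewrite mE; apply/QS/IH; move: md.
by rewrite {1}mE mdegD mdeg1 add1n ltnS.
Qed.

(** Both sides times a! b! (m - a - b)! equal m!. Applied in each variable, this gives the product
    rule [dpowmM]. *)
Lemma bin_trinomial m a b :
  ('C(m, a) * 'C(m - a, b) = 'C(a + b, b) * 'C(m, a + b))%N.
Proof.
case: (leqP (a + b) m) => [abm|mab]; last first.
  rewrite (bin_small mab) muln0; case: (leqP a m) => am.
    by rewrite ['C(m - a, b)]bin_small ?muln0 // ltn_subLR.
  by rewrite bin_small.
have am : (a <= m)%N := leq_trans (leq_addr b a) abm.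
have bma : (b <= m - a)%N by rewrite leq_subRL.
apply/eqP; rewrite -(eqn_pmul2r (fact_gt0 a)) -(eqn_pmul2r (fact_gt0 b)).
rewrite -(eqn_pmul2r (fact_gt0 (m - (a + b)))); apply/eqP.
have e1 := bin_fact am; have e2 := bin_fact bma; have e3 := bin_fact abm.
have := bin_fact (leq_addl a b); rewrite addnK => e4.
rewrite subnDA in e3 *; transitivity (m`!).
  by rewrite -e1 -e2; ring.
by rewrite -e3 -e4; ring.
Qed.

(** * Divided powers and the canonical filtration *)

Section OperatorBasis.
Local Open Scope classical_set_scope.
Variables (K : fieldType) (n : nat).
Local Notation P := {mpoly K[n]}.
Local Notation D := (diffop K n).
Local Notation xd a b := (mulop 'X_[a] * dpowm K b : D).
Implicit Types (u v w : D) (a b m : 'X_{1..n}).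

(** The scalar with which d^[b] acts on x^m, see [dpowm_X]. *)
Definition binm m b : nat := (\prod_(i < n) 'C(m i, b i))%N.

Lemma binm0 m b i : (m i < b i)%N -> binm m b = 0.
Proof. by move=> h; rewrite /binm (bigD1 i) //= bin_small ?mul0n. Qed.

Lemma binmm m : binm m m = 1.
Proof. by rewrite /binm big1 // => i _; rewrite binn. Qed.

Lemma binm_neq0 m b : (binm m b != 0)%N = (b <= m)%MM.
Proof.
apply/idP/mnm_lepP => [bm i|bm].
  by rewrite leqNgt; apply: contra bm => /binm0 ->.
by rewrite -lt0n /binm prodn_gt0 // => i; rewrite bin_gt0.
Qed.

Lemma diffop_mulE u v (q : P) : (u * v) q = u (v q).
Proof. by []. Qed.

Lemma diffop_addE u v (q : P) : (u + v) q = u q + v q.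
Proof. by []. Qed.

Lemma diffop_scaleE (c : K) u (q : P) : (c *: u) q = c *: u q.
Proof. by []. Qed.

Lemma diffop_sumE (I : Type) (r : seq I) (Q : pred I) (F : I -> D) (q : P) :
  (\sum_(i <- r | Q i) F i) q = \sum_(i <- r | Q i) F i q.
Proof. by elim/big_rec2: _ => // i x y _ <-. Qed.

Lemma mulopE (f q : P) : mulop f q = f * q.
Proof. by []. Qed.

Lemma mulop1 : mulop 1 = 1 :> D.
Proof. by []. Qed.

Lemma mulopM (f g : P) : mulop (f * g) = mulop f * mulop g :> D.
Proof. by apply/diffopP => q; rewrite diffop_mulE !mulopE mulrA. Qed.

Lemma dpowm_X b m : dpowm K b 'X_[m] = (binm m b)%:R *: 'X_[m - b].
Proof.
rewrite /dpowm /binm.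
have -> : (m - b = m - \sum_(i <- index_enum 'I_n) U_(i) *+ b i)%MM.
  by rewrite [in LHS](multinomUE_id b).
elim: (index_enum _) (index_enum_uniq 'I_n) => [_|i r IH /= /andP[ir ur]].
  by rewrite !big_nil mulopE mul1r scale1r subm0.
rewrite !big_cons diffop_mulE IH // linearZ /= dpow_funX scalerA.
(* As i is not in r, the operators already applied leave the exponent of x_i untouched. *)
have -> : (m - \sum_(j <- r) U_(j) *+ b j)%MM i = m i.
  rewrite mnmBE mnm_sumE big_seq big1 ?subn0 // => j jr.
  by rewrite mulmnE mnm1E; case: eqP jr ir => [-> ->|_ _ _] //; rewrite mul0n.
by rewrite submDA addmC mulrC -natrM mulnC.
Qed.

Lemma diffop_eqX u v : (forall m, u 'X_[m] = v 'X_[m]) -> u = v.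
Proof.
move=> uv; apply/diffopP => q; rewrite [q]mpolyE !linear_sum.
by apply: eq_bigr => m _; rewrite !linearZ /= uv.
Qed.

(** Pascal's rule in the variable i. The case split matters: for b_i = 0 truncated subtraction would
    return b itself instead of dropping the term. *)
Lemma dpowm_comm b i : dpowm K b * mulop 'X_i =
  mulop 'X_i * dpowm K b + (if (0 < b i)%N then dpowm K (b - U_(i))%MM else 0).
Proof.
apply: diffop_eqX => m; rewrite diffop_addE !diffop_mulE !mulopE -mpolyXD.
rewrite !dpowm_X -scalerAr -mpolyXD.
pose B := (\prod_(l < n | l != i) 'C(m l, b l))%N.
have BE (a c : 'X_{1..n}) : (forall l, l != i -> a l = m l) ->
    (forall l, l != i -> c l = b l) -> binm a c = ('C(a i, c i) * B)%N.
  move=> am cb; rewrite /binm (bigD1 i) //=; congr (_ * _)%N.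
  by apply: eq_bigr => l li; rewrite am ?cb.
rewrite (BE (U_(i) + m)%MM) // => [|l li]; last first.
  by rewrite mnmDE mnm1E eq_sym (negPf li).
rewrite (BE m b) // mnmDE mnm1E eqxx add1n.
case: (posnP (b i)) => [bi0|]; last case bE : (b i) => [//|k] _.
  rewrite bi0 !bin0 mul1n addr0; congr (_ *: 'X_[_]).
  apply/mnmP => l; rewrite !(mnmBE, mnmDE, mnm1E).
  by case: eqVneq => [<-|_]; rewrite ?bi0 ?subn0.
have eX : (U_(i) + m - b = m - (b - U_(i)))%MM.
  apply/mnmP => l; rewrite !(mnmBE, mnmDE, mnm1E).
  by case: eqVneq => [<-|_]; rewrite ?bE ?subn0 // subSS subn1.
rewrite dpowm_X (BE m (b - U_(i))%MM) // => [|l li]; last first.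
  by rewrite mnmBE mnm1E eq_sym (negPf li) subn0.
rewrite mnmBE mnm1E eqxx bE subn1 /= binS mulnDl natrD scalerDl -eX.
congr (_ + _); case: (leqP k.+1 (m i)) => km; last first.
  by rewrite bin_small // mul0n !scale0r.
congr (_ *: 'X_[_]); apply/mnmP => l; rewrite !(mnmBE, mnmDE, mnm1E).
by case: eqVneq => [<-|_] //; rewrite !add1n bE subSn.
Qed.

Lemma dpowmM b b' :
  dpowm K b * dpowm K b' = (binm (b' + b) b)%:R *: dpowm K (b' + b).
Proof.
apply: diffop_eqX => m; rewrite diffop_scaleE diffop_mulE !dpowm_X linearZ /=.
rewrite dpowm_X !scalerA -!natrM submDA; congr (_%:R *: _).
rewrite /binm -!big_split /=; apply: eq_bigr => i _.
by rewrite mnmBE mnmDE bin_trinomial.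
Qed.

Lemma canon_filt_xd i a b : (mdeg a + mdeg b <= i)%N -> canon_filt i (xd a b).
Proof.
move=> abi; exists 1, (fun=> 1), (fun=> a), (fun=> b); split=> //.
by rewrite big_ord1 scale1r.
Qed.

Lemma canon_filt_ind i (V : D -> Prop) :
  V 0 -> (forall (c : K) v w, V v -> V w -> V (c *: v + w)) ->
  (forall a b, (mdeg a + mdeg b <= i)%N -> V (xd a b)) ->
  forall u, canon_filt i u -> V u.
Proof.
move=> V0 VD Vxd u [k [c [a [b [ab ->]]]]].
elim/big_ind: _ => [//|v w Vv Vw|j _]; first by rewrite -[v]scale1r; exact: VD.
by rewrite -[_ *: _]addr0; exact/VD/V0/Vxd/ab.
Qed.

Lemma canon_filt0 i : canon_filt i (0 : D).
Proof.
exists 0, (fun=> 0), (fun=> 0%MM), (fun=> 0%MM); split=> [[]//|].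
by rewrite big_ord0.
Qed.

Lemma canon_filtD i (c : K) u v :
  canon_filt i u -> canon_filt i v -> canon_filt i (c *: u + v).
Proof.
move=> [k [cu [au [bu [uab ->]]]]] [l [cv [av [bv [vab ->]]]]].
exists (k + l)%N, (fun j => match split j with inl x => c * cu x | inr y => cv y end),
  (fun j => match split j with inl x => au x | inr y => av y end),
  (fun j => match split j with inl x => bu x | inr y => bv y end).
split=> [j|]; first by case: split.
rewrite big_split_ord /= scaler_sumr; congr (_ + _); apply: eq_bigr => j _.
  by rewrite -[lshift l j]/(unsplit (inl j)) unsplitK scalerA.
by rewrite -[rshift k j]/(unsplit (inr j)) unsplitK.
Qed.

Lemma canon_filtZ i (c : K) u : canon_filt i u -> canon_filt i (c *: u).
Proof. by move=> Fu; rewrite -[_ *: _]addr0; exact/canon_filtD/canon_filt0. Qed.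

Lemma canon_filtW i j u : (i <= j)%N -> canon_filt i u -> canon_filt j u.
Proof.
move=> ij [k [c [a [b [ab ->]]]]]; exists k, c, a, b; split=> // l.
exact: leq_trans (ab l) ij.
Qed.

Lemma canon_filt_mulop i a u :
  canon_filt i u -> canon_filt (mdeg a + i) (mulop 'X_[a] * u).
Proof.
move: u; apply: canon_filt_ind => [|c v w Fv Fw|a' b' ab].
- by rewrite mulr0; exact: canon_filt0.
- by rewrite mulrDr -scalerAr; exact: canon_filtD.
rewrite mulrA -mulopM -mpolyXD; apply: canon_filt_xd.
by rewrite mdegD -addnA leq_add2l.
Qed.

(** Each variable of x^a is moved to the left of d^[b] by [dpowm_comm]; the extra term loses one
    variable and one derivative, so the degree never grows. *)
Lemma canon_filt_dpowm i b u :
  canon_filt i u -> canon_filt (mdeg b + i) (dpowm K b * u).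
Proof.
move: u; apply: canon_filt_ind => [|c v w Fv Fw|a b' ab].
- by rewrite mulr0; exact: canon_filt0.
- by rewrite mulrDr -scalerAr; exact: canon_filtD.
apply: (@canon_filtW (mdeg b + (mdeg a + mdeg b'))); first by rewrite leq_add2l.
elim/mnm_ind: a {ab} b => [|j a IH] b.
  rewrite mpolyX0 mulop1 mul1r dpowmM mdeg0 add0n; apply: canon_filtZ.
  rewrite -[dpowm _ _]mul1r -mulop1 -mpolyX0; apply: canon_filt_xd.
  by rewrite mdeg0 mdegD add0n addnC.
rewrite mpolyXD mulopM -!mulrA mulrA dpowm_comm mulrDl -[X in X + _]scale1r.
apply: canon_filtD.
  rewrite -mulrA; apply: canon_filtW (canon_filt_mulop U_(j)%MM (IH b)).
  by rewrite mdegD mdeg1; lia.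
case: posnP => bj; first by rewrite mul0r; exact: canon_filt0.
apply: canon_filtW (IH _); rewrite mdegD !addnA leq_add2r leq_add2r.
by apply: leq_trans (leq_addr _ _); exact: mdegB.
Qed.

Lemma canon_filtM i j u v :
  canon_filt i u -> canon_filt j v -> canon_filt (i + j) (u * v).
Proof.
move=> Fu Fv; move: u Fu; apply: canon_filt_ind => [|c w w' Fw Fw'|a b ab].
- by rewrite mul0r; exact: canon_filt0.
- by rewrite mulrDl -scalerAl; exact: canon_filtD.
rewrite -mulrA; apply: canon_filtW (canon_filt_mulop _ (canon_filt_dpowm _ Fv)).
by rewrite addnA leq_add2r.
Qed.

Lemma diffop_lt_mull k (p : P) (f : P -> P) :
  diffop_lt k f -> diffop_lt k (fun q => p * f q).
Proof.
elim: k f => [|k IH] f fk; first by move=> q; rewrite fk mulr0.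
move=> g; apply: diffop_lt_ext (IH _ (fk g)) => q.
by rewrite /comm_op mulrBr [g * (p * _)]mulrCA.
Qed.

Lemma diffop_lt_dpowm b : diffop_lt (mdeg b).+1 (dpowm K b).
Proof.
have [d] := ubnP (mdeg b); elim: d b => // d IH b bd.
apply: diffop_lt_gen => [|i]; first exact: diffop_linear.
have cE q : (if (0 < b i)%N then dpowm K (b - U_(i))%MM else 0) q =
    comm_op (dpowm K b) 'X_i q.
  have <- : (dpowm K b * mulop 'X_i - mulop 'X_i * dpowm K b : D) q =
      comm_op (dpowm K b) 'X_i q.
    by rewrite diffop_addE -[- (_ * _)]scaleN1r diffop_scaleE scaleN1r.
  by rewrite dpowm_comm addrC addKr.
apply: diffop_lt_ext cE _; case: posnP => [_|bi]; first exact: diffop_lt0.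
have bE : mdeg b = (mdeg (b - U_(i))).+1.
  by rewrite -[in LHS](@submK _ U_(i) b) ?lep1mP -?lt0n // mdegD mdeg1 addn1.
by rewrite bE; apply: IH; rewrite -ltnS -bE.
Qed.

(** By induction every commutator of f with a variable vanishes, so f commutes with the variables
    and is determined by f(1) = 0. *)
Lemma diffop_lt_eq0 k (f : P -> P) : linear f -> diffop_lt k f ->
  (forall m, (mdeg m < k)%N -> f 'X_[m] = 0) -> forall q, f q = 0.
Proof.
elim: k f => [|k IH] f fL fk fX; first exact: fk.
have fC i q : f ('X_i * q) = 'X_i * f q.
  apply/eqP; rewrite -subr_eq0; apply/eqP.
  apply: (IH (comm_op f 'X_i)) => [||m mk]; [exact: comm_op_linear|exact: fk|].
  rewrite /comm_op -mpolyXD !fX ?mulr0 ?subrr //; first exact: ltnW.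
  by rewrite mdegD mdeg1.
have f0 m : f 'X_[m] = 0.
  elim/mnm_ind: m => [|i m IHm]; first by rewrite fX // mdeg0.
  by rewrite mpolyXD fC IHm mulr0.
elim/mpolyind => [|c m p _ _ IHp]; last by rewrite fL f0 IHp scaler0 addr0.
by have := fL (-1) 0 0; rewrite scaler0 addr0 scaleN1r addNr.
Qed.

(* Matching the values on monomials degree by degree: an operator of order < k
   killing the polynomials of degree < k is zero. *)
Lemma canon_filt_exhaustive u : exists i, canon_filt i u.
Proof.
have Fsum (I : Type) (r : seq I) (F : I -> D) :
    (forall j, exists i, canon_filt i (F j)) ->
    exists i, canon_filt i (\sum_(j <- r) F j).
  move=> FF; elim: r => [|j r [i Fi]].
    by exists 0; rewrite big_nil; exact: canon_filt0.
  have [l Fl] := FF j; exists (maxn l i); rewrite big_cons -[F j]scale1r.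
  by apply: canon_filtD; [exact: canon_filtW (leq_maxl _ _) Fl
                         |exact: canon_filtW (leq_maxr _ _) Fi].
have Fmul (f : P) v : (exists i, canon_filt i v) ->
    exists i, canon_filt i (mulop f * v).
  move=> [i Fv]; rewrite [f]mpolyE.
  have -> : mulop (\sum_(m <- msupp f) f@_m *: 'X_[m]) * v =
      \sum_(m <- msupp f) f@_m *: (mulop 'X_[m] * v).
    apply/diffopP => q; rewrite diffop_sumE diffop_mulE mulopE mulr_suml.
    by apply: eq_bigr => m _; rewrite -scalerAl.
  by apply: Fsum => m; exists (mdeg m + i)%N; exact/canon_filtZ/canon_filt_mulop.
have [k uk] := diffop_order u.
(* [v] kills the monomials of degree below j, and d bounds the number of degrees left before
   [diffop_lt_eq0] applies. *)
suff step d : forall j v, (k <= j + d)%N -> diffop_lt k v ->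
    (forall m, (mdeg m < j)%N -> v 'X_[m] = 0) -> exists i, canon_filt i v.
  by apply: (step k 0%N).
elim: d => [|d IH] j v kjd vk vX.
  exists 0; suff -> : v = 0 by exact: canon_filt0.
  apply/diffopP => q; apply: (diffop_lt_eq0 (diffop_linear v) vk) => m mk.
  by apply: vX; apply: leq_trans mk _; rewrite addn0 in kjd.
have [kj|jk] := leqP k j.
  by apply: (IH j) => //; exact: leq_trans kj (leq_addr _ _).
pose I := [seq m <- [seq bmnm m | m : 'X_{1..n < j.+1}] | mdeg m == j].
(* For |g| = j, d^[g] maps x^g to 1 and kills all other monomials of degree at most j; so w agrees
   with v in degree j and vanishes below. *)
pose w := \sum_(g <- I) mulop (v 'X_[g]) * dpowm K g.
have wX m : (mdeg m <= j)%N -> w 'X_[m] = if mdeg m == j then v 'X_[m] else 0.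
  move=> mj; rewrite /w diffop_sumE.
  have dX g : (mdeg g == j)%N -> g != m -> dpowm K g 'X_[m] = 0.
    move=> /eqP gj gm; rewrite dpowm_X.
    have [->|] := eqVneq (binm m g) 0; first by rewrite scale0r.
    rewrite binm_neq0 => gm'; case/eqP: gm.
    have := congr1 mdeg (submK gm'); rewrite mdegD gj => e.
    have /eqP : mdeg (m - g) = 0 by lia.
    by rewrite mdeg_eq0 => /eqP e0; rewrite -(submK gm') e0 add0m.
  case: ifP => mj'; last first.
    rewrite big_seq big1 // => g; rewrite mem_filter => /andP[gj _].
    rewrite diffop_mulE dX ?linear0 //; apply: contraFN mj' => /eqP <-.
    by rewrite gj.
  rewrite (bigD1_seq m) /=; last first.
  - by rewrite filter_uniq // map_inj_uniq ?enum_uniq //; exact: val_inj.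
  - rewrite mem_filter mj' /=; apply/mapP.
    by exists (BMultinom (mj : (mdeg m < j.+1)%N)); rewrite ?mem_enum.
  rewrite dpowm_X binmm scale1r (_ : m - m = 0)%MM; last first.
    by apply/mnmP => l; rewrite mnmBE subnn mnm0E.
  rewrite mpolyX0 mulr1.
  rewrite big_seq_cond big1 ?addr0 // => g; rewrite mem_filter.
  by move=> /andP[/andP[gj _] gm]; rewrite dX // mulr0.
have [i Fi] : exists i, canon_filt i w.
  apply: Fsum => g; apply: Fmul; exists (mdeg g).
  by rewrite -[dpowm _ _]mul1r -mulop1 -mpolyX0; apply: canon_filt_xd; rewrite mdeg0.
have vwX m : (mdeg m <= j)%N -> (v - w) 'X_[m] = 0.
  move=> mj; rewrite diffop_addE -[- w]scaleN1r diffop_scaleE scaleN1r wX //.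
  by case: eqP => [_|/eqP mj']; rewrite ?subrr // subr0 vX // ltn_neqAle mj'.
have [l Fl] : exists l, canon_filt l (v - w).
  apply: (IH j.+1) => //; first by rewrite addSnnS.
  apply: (@diffop_lt_ext _ _ _ (fun q => v q + (-1) *: w q)) => [q|].
    by rewrite diffop_addE -[- w]scaleN1r diffop_scaleE.
  (* The terms of w have order at most j < k, so subtracting w keeps the order below k. *)
  apply: diffop_ltD vk (diffop_ltZ _ _).
  apply: (@diffop_lt_ext _ _ _
      (fun q => \sum_(g <- I) v 'X_[g] * dpowm K g q)) => [q|].
    by rewrite /w diffop_sumE.
  have : all (fun g => mdeg g == j) I by exact: filter_all.
  elim: (I) => [_|g r IHr /= /andP[/eqP gj rj]].
    by apply: diffop_lt_ext (diffop_lt0 _ _ _) => q; rewrite big_nil.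
  apply: diffop_lt_ext (diffop_ltD _ (IHr rj)) => [q|]; first by rewrite big_cons.
  apply: diffop_ltW jk _; rewrite -gj; apply: diffop_lt_mull.
  exact: diffop_lt_dpowm.
exists (maxn l i); rewrite -[v](subrK w) -[v - w]scale1r.
by apply: canon_filtD; [exact: canon_filtW (leq_maxl _ _) Fl
                       |exact: canon_filtW (leq_maxr _ _) Fi].
Qed.
End OperatorBasis.

(** * Growth exponents *)

Section Growth.
Local Open Scope classical_set_scope.
Variable R : realType.

Lemma powR_unbounded (e C : R) : 0 < e -> \forall i \near \oo, C <= i%:R `^ e.
Proof.
move=> e0; near=> i; apply: (le_trans (ler_norm C)).
have -> : `|C| = (`|C| `^ e^-1) `^ e.
  by rewrite -powRrM mulVf ?gt_eqF // powRr1.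
apply: ge0_ler_powR; rewrite ?nnegrE ?powR_ge0 //; first exact: ltW.
by near: i; exact: nbhs_infty_ger.
Unshelve. all: by end_near. Qed.

(** Constants are absorbed by i^e, so d + e is admissible for every e > 0. An admissible r < d would
    fail along i = k q^j + N, which is why the lower bound on W is asked only at powers of q. *)
Lemma gamma_eq (f W : nat -> nat) (d C c : R) (N k q : nat) :
  0 < d -> 0 < c -> 0 <= C -> (0 < k)%N -> (1 < q)%N ->
  (forall i, f i <= W (i + N).+1)%N ->
  (forall s, W s <= f (k * s + N))%N ->
  (forall s, (0 < s)%N -> (W s)%:R <= C * s%:R `^ d) ->
  (forall j, c * (q ^ j)%N%:R `^ d <= (W (q ^ j)%N)%:R) ->
  gamma R f = d%:E.
Proof.
move=> d0 c0 C0 k0 q1 fW Wf WC cW; apply/eqP; rewrite eq_le; apply/andP; split.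
  apply/lee_addgt0Pr => e e0; apply: ge_ereal_inf; exists (d + e)%:E => //.
  exists (d + e) => //=.
  have := powR_unbounded (C * (N.+2)%:R `^ d) e0.
  apply: filter_app; near=> i => iC.
  have i0 : (0 < i)%N by near: i; exact: nbhs_infty_gt.
  apply: (@le_trans _ _ (C * (N.+2)%:R `^ d * i%:R `^ d)); last first.
    rewrite powRD ?(gt_eqF (ltr_wpDl (ltW d0) e0)) // [leRHS]mulrC.
    by rewrite ler_wpM2r // powR_ge0.
  apply: (@le_trans _ _ ((W (i + N).+1)%:R)); first by rewrite ler_nat.
  apply: (le_trans (WC _ _)) => //.
  rewrite -mulrA -powRM // ler_wpM2l // ge0_ler_powR ?nnegrE ?mulr_ge0 //.
    exact: ltW.
  by rewrite -natrM ler_nat; nia.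
apply/ereal_infP => _ [r [i0 _ fr] <-]; rewrite lee_fin leNgt; apply/negP => rd.
(* Passing to r' >= 0 makes the power monotone in its base. *)
pose r' := Num.max r 0; have r'd : r' < d by rewrite gt_max rd.
have r'0 : 0 <= r' by rewrite le_max lexx orbT.
have dr' : 0 < d - r' by rewrite subr_gt0.
(* This threshold makes c X^(d - r') exceed (k + N)^r'; the summand 1 makes the inequality
   strict. *)
have [j0 _ Hj] := powR_unbounded ((k + N)%:R `^ r' / c + 1) dr'.
pose j := maxn i0 j0; pose X := (q ^ j)%N.
have jX : (j < X)%N by exact: ltn_expl.
have X0 : (0 < X)%N by exact: leq_trans jX.
have {}Hj := Hj X (leq_trans (leq_maxr i0 j0) (ltnW jX)).
have i0X : (i0 <= k * X + N)%N.
  apply: leq_trans (leq_maxl i0 j0) _; apply: leq_trans (ltnW jX) _.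
  by rewrite -/X; nia.
have : c * X%:R `^ d <= (k + N)%:R `^ r' * X%:R `^ r'.
  apply: le_trans (cW j) _; apply: (@le_trans _ _ (f (k * X + N))%:R).
    by rewrite ler_nat.
  apply: le_trans (fr _ i0X) _.
  apply: (@le_trans _ _ ((k * X + N)%:R `^ r')).
    by apply: ler_powR; [rewrite ler1n; nia|rewrite le_max lexx].
  rewrite -powRM // -natrM; apply: ge0_ler_powR; rewrite ?nnegrE //.
  by rewrite ler_nat; nia.
have XR : 0 < X%:R `^ r' by rewrite powR_gt0 // ltr0n.
rewrite -[d](subrK r') powRD; last by rewrite subrK gt_eqF.
rewrite mulrA ler_pM2r // leNgt => /negP; apply.
rewrite mulrC -ltr_pdivrMr //; apply: lt_le_trans Hj.
by rewrite ltrDl.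
Unshelve. all: by end_near. Qed.
End Growth.

(** * Binomial coefficients in characteristic p *)

Section BinomialCharP.
Variables (K : fieldType) (p : nat) (charKp : p \in [pchar K]).

(** With q = p^k, j C(q, j) = q C(q - 1, j - 1); if p did not divide C(q, j), then q would divide j
    < q. *)
Lemma bin_expn_char0 k j : (0 < j < p ^ k)%N -> 'C(p ^ k, j)%:R = 0 :> K.
Proof.
move=> /andP[j0 jk]; apply/eqP; rewrite -(dvdn_pcharf charKp).
have p_pr := pcharf_prime charKp.
apply: contraLR jk => pC; rewrite -leqNgt dvdn_leq //.
have : (p ^ k %| j * 'C(p ^ k, j))%N.
  case: j j0 pC => // j _ _; rewrite -mul_bin_diag; exact: dvdn_mulr.
by rewrite Gauss_dvdl // coprimeXl // prime_coprime.
Qed.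

(** Coefficient form of (1 + X)^(q + m) = (1 + X^q) (1 + X)^m for q = p^k: in Vandermonde's sum only
    the indices 0 and q survive. *)
Lemma bin_expn_charD k m b : 'C(p ^ k + m, b)%:R =
  'C(m, b)%:R + (if (p ^ k <= b)%N then 'C(m, b - p ^ k)%:R else 0) :> K.
Proof.
have q0 : (0 < p ^ k)%N by rewrite expn_gt0 prime_gt0 // (pcharf_prime charKp).
rewrite -binomial.Vandermonde big_ord_recl bin0 mul1n subn0 natrD; congr (_ + _).
rewrite natr_sum; case: leqP => qb; last first.
  rewrite big1 // => i _; rewrite natrM bin_expn_char0 ?mul0r // lift0 /=.
  exact: leq_ltn_trans (ltn_ord i) qb.
have qb' : ((p ^ k).-1 < b)%N by rewrite prednK.
rewrite (bigD1 (Ordinal qb')) //= /bump /= add1n prednK // binn mul1n.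
rewrite big1 ?addr0 // => i; rewrite -val_eqE /= => iq; rewrite add1n natrM.
have [iq'|iq'|iq'] := ltngtP i.+1 (p ^ k).
- by rewrite bin_expn_char0 ?mul0r.
- by rewrite bin_small ?mul0r.
- by case/eqP: iq; rewrite -iq'.
Qed.

(** By Pascal's rule and the vanishing of C(q, b + 1), C(q - 1, b + 1) = - C(q - 1, b), so the value
    is (-1)^b. *)
Lemma bin_expn_pred_char_neq0 k b :
  (b < p ^ k)%N -> 'C((p ^ k).-1, b)%:R != 0 :> K.
Proof.
elim: b => [|b IH] bk; first by rewrite bin0 oner_eq0.
have := @bin_expn_char0 k b.+1 bk.
rewrite -[in 'C(_, _)](ltn_predK bk) binS natrD => /eqP.
by rewrite addr_eq0 => /eqP ->; rewrite oppr_eq0 IH // ltnW.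
Qed.

End BinomialCharP.

(** * Dimension of a cyclic module with a monomial basis *)

Section MonomialBasis.
Local Open Scope classical_set_scope.
Variables (K : fieldType) (n : nat).
Local Notation D := (diffop K n).
Local Notation xd a b := (mulop 'X_[a] * dpowm K b : D).
Variables (E T : pred nat).
Variables (M : lmodType D) (v : M).
Hypothesis v_gen : forall x : M, exists u : D, x = u *: v.

(** [E] marks the variables allowed in x^a, [T] the exponents allowed in d^[b]. The real case takes
    all variables and a digit set [T], the finitely presented case [E = leq j] and every
    exponent. *)
Definition good_exp (a b : 'X_{1..n}) :=
  [forall l : 'I_n, (E l || (a l == 0%N)) && T (b l)].

Definition mnm_ffun s (f : {ffun 'I_n -> 'I_s}) : 'X_{1..n} :=
  [multinom (f i : nat) | i < n].

(** Cubes replace the simplices of the filtration: their cardinality is a product, and the two are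
    comparable up to rescaling. *)
Definition good_box s : {pred {ffun 'I_n -> 'I_s} * {ffun 'I_n -> 'I_s}} :=
  fun x => good_exp (mnm_ffun x.1) (mnm_ffun x.2).
Arguments good_box s : clear implicits.

Definition good_family s (j : 'I_#|good_box s|) : M :=
  xd (mnm_ffun (enum_val j).1) (mnm_ffun (enum_val j).2) *: v.

Hypothesis v_reduce : forall a b, exists (c : K) a' b',
  [/\ good_exp a' b', (mdeg a' + mdeg b' <= mdeg a + mdeg b)%N &
      xd a b *: v = c%:A *: (xd a' b' *: v)].
Hypothesis v_free : forall s, kfree (good_family (s := s)).

Let Fv i := [set x : M | exists2 u, canon_filt i u & x = u *: v].

Let Fv_subspace i : ksubspace (Fv i).
Proof.
split=> [|c _ _ [u Fu ->] [w Fw ->]].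
  by exists 0; [exact: canon_filt0|rewrite scale0r].
by exists (c *: u + w); [exact: canon_filtD|rewrite kscaleA scalerDl].
Qed.

Lemma mnm_ffun_onto s (a : 'X_{1..n}) : (forall l, (a l < s)%N) ->
  exists f : {ffun 'I_n -> 'I_s}, mnm_ffun f = a.
Proof.
move=> als; exists [ffun l => Ordinal (als l)].
by apply/mnmP => l; rewrite mnmE ffunE.
Qed.

Lemma mnm_ffun_inj s : injective (@mnm_ffun s).
Proof.
move=> f g fg; apply/ffunP => l; apply: val_inj.
by have /mnmP/(_ l) := fg; rewrite !mnmE.
Qed.

Lemma mdeg_mnm_ffun s (f : {ffun 'I_n -> 'I_s}) : (mdeg (mnm_ffun f) <= n * s)%N.
Proof.
rewrite mdegE -[n in (n * s)%N]card_ord -sum_nat_const.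
by apply: leq_sum => l _; rewrite mnmE ltnW.
Qed.

Lemma mnm_lt_mdeg (a : 'X_{1..n}) i l : (mdeg a <= i)%N -> (a l < i.+1)%N.
Proof.
move=> ai; rewrite ltnS; apply: leq_trans ai.
by rewrite mdegE (bigD1 l) //= leq_addr.
Qed.

Let Fv_sub i : Fv i `<=` kspan (good_family (s := i.+1)).
Proof.
move=> _ [u + ->]; move: u; apply: canon_filt_ind => [|c u w Fu Fw|a b ab].
- by rewrite scale0r; case: (kspan_subspace (good_family (s := i.+1))).
- rewrite scalerDl -kscaleA.
  by have [_] := kspan_subspace (good_family (s := i.+1)); apply.
have [c [a' [b' [gab ab' ->]]]] := v_reduce a b.
apply: ksubspaceZ; first exact: kspan_subspace.
have abi := leq_trans ab' ab.
have [f fE] : exists f : {ffun 'I_n -> 'I_i.+1}, mnm_ffun f = a'.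
  by apply: mnm_ffun_onto => l; apply/mnm_lt_mdeg/leq_trans/abi/leq_addr.
have [g gE] : exists g : {ffun 'I_n -> 'I_i.+1}, mnm_ffun g = b'.
  by apply: mnm_ffun_onto => l; apply/mnm_lt_mdeg/leq_trans/abi/leq_addl.
have fg : (f, g) \in good_box i.+1 by rewrite unfold_in /good_box /= fE gE.
suff -> : xd a' b' *: v = good_family (enum_rank_in fg (f, g)).
  exact: kspan_mem.
by rewrite /good_family enum_rankK_in //= fE gE.
Qed.

Lemma prodset_subspace i (V : set M) : ksubspace (prodset (@canon_filt K n i) V).
Proof.
split=> [|c _ _ [k [a [x [ax ->]]]] [l [b [y [by_ ->]]]]].
  by exists 0, (fun=> 0), (fun=> 0); split=> [[]//|]; rewrite big_ord0.
exists (k + l)%N,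
  (fun j => match split j with inl j => c *: a j | inr j => b j end),
  (fun j => match split j with inl j => x j | inr j => y j end).
split=> [j|].
  case: split => j'; last exact: by_.
  by have [? ?] := ax j'; split=> //; exact: canon_filtZ.
rewrite big_split_ord /= scaler_sumr; congr (_ + _); apply: eq_bigr => j _.
  by rewrite -[lshift l j]/(unsplit (inl j)) unsplitK kscaleA.
by rewrite -[rshift k j]/(unsplit (inr j)) unsplitK.
Qed.

Lemma canon_filt_uniform k (u : 'I_k -> D) :
  exists N, forall j, canon_filt N (u j).
Proof.
have /choice[N Fu] j := canon_filt_exhaustive (u j).
exists (\max_j N j) => j; exact: canon_filtW (leq_bigmax j) (Fu j).
Qed.

(** V lies in F_N v and v in F_N V, so exchanging V and v shifts the filtration by N only. Exponents
    of degree at most i are below i + 1, and a cube of side s has degree at most 2ns. Every V is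
    covered, since [Dim] does not tell which one is picked. *)
Lemma kdim_filt_bounds (V : set M) : generating_subspace V -> exists N,
  (forall i, kdim (prodset (@canon_filt K n i) V) <= #|good_box (i + N).+1|)%N /\
  (forall s, #|good_box s| <= kdim (prodset (@canon_filt K n (2 * n * s + N)) V))%N.
Proof.
move=> [[k [b [_ VE]]] VT].
have /choice[w bw] j := v_gen (b j).
have [N1 Fw] := canon_filt_uniform w.
have [l [u [x [ux vE]]]] : prodset setT V v by rewrite VT.
have [N2 Fu] := canon_filt_uniform u.
pose N := maxn N1 N2; exists N.
have VF : V `<=` Fv N.
  rewrite VE; apply: kspan_sub => // j; rewrite bw; exists (w j) => //.
  exact: canon_filtW (leq_maxl _ _) (Fw j).
have sub i : prodset (@canon_filt K n i) V `<=` Fv (i + N).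
  move=> _ [r [a [y [ay ->]]]]; apply: ksubspace_sum => // j _.
  have [Fa /VF[u' Fu' ->]] := ay j; exists (a j * u'); last by rewrite scalerA.
  exact: canon_filtM.
have subk i := subset_trans (sub i) (@Fv_sub (i + N)).
split=> [i|s]; first exact: kdim_leq (prodset_subspace _ _) (subk i).
apply: kdim_geq (prodset_subspace _ _) (subk _) (@v_free s) _ => j.
rewrite /good_family; set a := mnm_ffun _; set b' := mnm_ffun _.
exists l, (fun r => xd a b' * u r), x; split=> [r|]; last first.
  by rewrite {1}vE scaler_sumr; apply: eq_bigr => r _; rewrite scalerA.
split; last by case: (ux r).
apply: canon_filtM; last exact: canon_filtW (leq_maxr _ _) (Fu r).
apply: canon_filt_xd; rewrite -mulnA mul2n -addnn.
by apply: leq_add; exact: mdeg_mnm_ffun.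
Qed.

(** A witness, so that [xget] in [Dim] returns a generating subspace and not its default. *)
Lemma cyclic_generating : generating_subspace (kspan (fun _ : 'I_1 => v)).
Proof.
split.
  have sub_v : ksubspace (kspan (fun _ : 'I_1 => v)) := kspan_subspace _.
  by have [k _ ?] := has_kdim_sub sub_v (@subset_refl _ _); exists k.
apply/seteqP; split=> // x _; have [u ->] := v_gen x.
exists 1, (fun=> u), (fun=> v); split; last by rewrite big_ord1.
by move=> j; split=> //; exact: (kspan_mem (fun _ : 'I_1 => v) ord0).
Qed.

Lemma Dim_eq (R : realType) (d C c : R) (q : nat) :
  (0 < n)%N -> 0 < d -> 0 < c -> 0 <= C -> (1 < q)%N ->
  (forall s, (0 < s)%N -> #|good_box s|%:R <= C * s%:R `^ d) ->
  (forall j, c * (q ^ j)%N%:R `^ d <= #|good_box (q ^ j)|%:R) ->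
  Dim R M = d%:E.
Proof.
move=> n0 d0 c0 C0 q1 boxC cbox; rewrite /Dim.
set V := xget _ _; have : generating_subspace V by exact: xgetI cyclic_generating.
case/kdim_filt_bounds => N [ub lb].
by apply: (@gamma_eq R _ (fun s => #|good_box s|) d C c N (2 * n) q) => //;
  rewrite muln_gt0.
Qed.

End MonomialBasis.

(** * Counting the basis vectors in a cube *)

Section Counting.
Variables (n : nat) (E T : pred nat).

Lemma card_ord_pred s (Q : pred nat) : #|[pred x : 'I_s | Q x]| = count Q (iota 0 s).
Proof.
rewrite -val_enum_ord count_map cardE size_filter -enumT.
by apply: eq_count => x; rewrite !inE.
Qed.

Lemma card_good_box s : (0 < s)%N -> #|@good_box n E T s| =
  (s ^ count E (iota 0 n) * count T (iota 0 s) ^ n)%N.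
Proof.
case: s => // s _; rewrite -!card_ord_pred.
(* f ranges over the maps vanishing outside [E], g over the maps into [T]. *)
have <- : #|pffun_on ord0 [pred l : 'I_n | E l] (@predT 'I_s.+1)| =
    (s.+1 ^ #|[pred l : 'I_n | E l]|)%N by rewrite card_pffun_on card_ord.
have <- : #|ffun_on [pred x : 'I_s.+1 | T x] : pred {ffun 'I_n -> 'I_s.+1}| =
    (#|[pred x : 'I_s.+1 | T x]| ^ n)%N by rewrite card_ffun_on card_ord.
rewrite -cardX.
apply: eq_card => -[f g]; rewrite [LHS]unfold_in /good_box /=.
rewrite /good_exp /= [RHS]inE /=; apply/forallP/andP => [fg|[fE gT] l].
  split; last first.
    by apply/ffun_onP => l; have /andP[_] := fg l; rewrite mnmE.
  apply/pffun_onP; split=> //; apply/fintype.subsetP => l; rewrite !inE.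
  have /andP[+ _] := fg l; rewrite mnmE => /orP[//|/eqP fl0].
  by move=> /eqP[]; apply: val_inj.
rewrite !mnmE; have /ffun_onP/(_ l) := gT; rewrite inE => ->; rewrite andbT.
have /pffun_onP[/fintype.subsetP/(_ l) + _] := fE; rewrite !inE.
by case: (E l) => //= fl; apply/eqP; apply: contrapT => fl0; apply: notF;
  apply: fl; apply: contra_notN fl0 => /eqP ->.
Qed.

End Counting.

(** * Linear independence by test monomials *)

Section Independence.
Variables (K : fieldType) (n p : nat) (charKp : p \in [pchar K]).
Local Notation D := (diffop K n).
Local Notation xd a b := (mulop 'X_[a] * dpowm K b : D).
Variables (E T : pred nat) (M : lmodType D) (v : M).

(** In the variables of [E] only exponents up to b survive differentiation; in the others every
    C(p^k - 1, c) with c < p^k is nonzero in K. *)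
Definition test_exp k (b : 'X_{1..n}) : 'X_{1..n} :=
  [multinom (if E l then b l else (p ^ k).-1) | l < n].

Hypothesis v_annihil : forall u : D, u *: v = 0 -> exists k0,
  forall k (b e : 'X_{1..n}),
  (k0 <= k)%N -> (forall l, T (b l)) ->
  (forall l : 'I_n, ~~ E l -> (e l < p ^ k)%N) -> (u 'X_[test_exp k b])@_e = 0.

(* Tested on the monomial of exponent [test_exp k b], the terms whose
   derivation exponent is not smaller than [b] contribute to the coefficient
   of the term [xd a b] only through [xd a b] itself. *)
Lemma good_family_free s : kfree (@good_family K n E T M v s).
Proof.
move=> c c0; pose A j := mnm_ffun (enum_val (A := @good_box n E T s) j).1.
pose B j := mnm_ffun (enum_val (A := @good_box n E T s) j).2.
pose u : D := \sum_j c j *: xd (A j) (B j).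
have uv0 : u *: v = 0.
  rewrite -[RHS]c0 scaler_suml; apply: eq_bigr => j _.
  by rewrite /good_family kscaleA.
have AB_inj j j' : A j = A j' -> B j = B j' -> j = j'.
  move=> /mnm_ffun_inj e1 /mnm_ffun_inj e2; apply: enum_val_inj.
  by rewrite [LHS]surjective_pairing e1 e2 -surjective_pairing.
have gAB j : good_exp E T (A j) (B j) by have := enum_valP j; rewrite unfold_in.
have Bs j l : (B j l < s)%N by rewrite mnmE.
have p_gt1 := prime_gt1 (pcharf_prime charKp).
have [k0 uk] := v_annihil uv0; pose k := maxn k0 s.
have sk : (s <= p ^ k)%N.
  by apply: leq_trans (ltnW (ltn_expl k p_gt1)); exact: leq_maxr.
have q0 : (0 < p ^ k)%N by rewrite expn_gt0 ltnW.
(* Induction on the degree of [B j]: terms of smaller derivation degree already have coefficient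
   zero. *)
suff c0' d : forall j, (mdeg (B j) < d)%N -> c j = 0 by move=> j; exact: c0'.
elim: d => // d IH j; rewrite ltnS leq_eqVlt => /orP[/eqP Bd|]; last exact: IH.
have /forallP gj := gAB j.
pose m := test_exp k (B j); pose e := (A j + (m - B j))%MM.
have mE (l : 'I_n) : m l = if E l then B j l else (p ^ k).-1.
  by rewrite [LHS]mnmE.
have Bm j' (l : 'I_n) : ~~ E l -> (B j' l <= m l)%N.
  move=> El; rewrite mE (negPf El) -ltnS prednK //.
  exact: leq_trans (Bs j' l) sk.
have AE0 j' (l : 'I_n) : ~~ E l -> A j' l = 0%N.
  by move=> /negPf El; have /forallP/(_ l) := gAB j'; rewrite El => /andP[/eqP].
have uke : (u 'X_[m])@_e = 0.
  apply: uk => [|l|l El]; first exact: leq_maxl; first by have /andP[] := gj l.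
  rewrite mnmDE (AE0 _ _ El) mnmBE add0n; apply: leq_ltn_trans (leq_subr _ _) _.
  by rewrite mE (negPf El) prednK.
have binmB : (binm m (B j))%:R != 0 :> K.
  rewrite /binm natr_prod; apply/prodf_neq0 => l _; rewrite mE.
  case: ifP => _; first by rewrite binn oner_eq0.
  by apply: (bin_expn_pred_char_neq0 charKp); exact: leq_trans (Bs j l) sk.
have termE j' : (c j' *: xd (A j') (B j')) 'X_[m] =
    (c j' * (binm m (B j'))%:R) *: 'X_[A j' + (m - B j')].
  rewrite diffop_scaleE diffop_mulE dpowm_X mulopE -scalerAr scalerA.
  by rewrite -mpolyXD.
move: uke; rewrite diffop_sumE (eq_bigr _ (fun j' _ => termE j')).
rewrite raddf_sum (bigD1 j) //= big1 => [|j' jj'].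
  rewrite addr0 mcoeffZ mcoeffX eqxx mulr1 => /eqP.
  by rewrite mulf_eq0 (negPf binmB) orbF => /eqP.
rewrite mcoeffZ mcoeffX; have [/IH ->|Bd'] := ltnP (mdeg (B j')) d.
  by rewrite !mul0r.
have [->|] := eqVneq (binm m (B j')) 0%N; first by rewrite mulr0 mul0r.
rewrite binm_neq0 => /mnm_lepP B'm; case: eqP => [eE|]; last by rewrite mulr0.
(* In [E], m equals [B j]; outside, the x-exponents vanish, so equal images have equal derivation
   exponents. As [B j'] has degree at least d, it equals [B j]. *)
case/eqP: jj'; have BB l : (B j' l <= B j l)%N.
  have [El|El] := boolP (E l); first by have := B'm l; rewrite mE El.
  have /mnmP/(_ l) := eE; rewrite !(mnmDE, mnmBE) !(AE0 _ _ El) !add0n.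
  by have := Bm j l El; have := Bm j' l El; lia.
have BE : B j' = B j.
  have /mnm_lepP B'B := BB; rewrite -(submK B'B).
  have : mdeg (B j - B j')%MM = 0%N.
    by have := congr1 mdeg (submK B'B); rewrite mdegD; lia.
  by move/eqP; rewrite mdeg_eq0 => /eqP ->; rewrite add0m.
apply: AB_inj => //; move: eE; rewrite /e BE => /(congr1 (fun x => x - (m - B j))%MM).
by rewrite !addmK.
Qed.
End Independence.

(** * Finite presentation of cyclic modules *)

Section FinitePresentation.
Variables (A : nzRingType) (M : lmodType A) (v : M) (m : nat) (w : 'I_m -> A).

Definition row_comb (r : 'rV[A]_m) : 'rV[A]_1 := \row__ \sum_l r 0 l * w l.
Fact row_comb_linear : linear row_comb.
Proof.
move=> a x y; apply/rowP => i; rewrite !mxE mulr_sumr -big_split /=.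
by apply: eq_bigr => l _; rewrite !mxE mulrDl mulrA.
Qed.
HB.instance Definition _ :=
  GRing.isLinear.Build A 'rV[A]_m 'rV[A]_1 *:%R row_comb row_comb_linear.

Definition row_act (r : 'rV[A]_1) : M := r 0 0 *: v.
Fact row_act_linear : linear row_act.
Proof. by move=> a x y; rewrite /row_act !mxE scalerDl scalerA. Qed.
HB.instance Definition _ :=
  GRing.isLinear.Build A 'rV[A]_1 M *:%R row_act row_act_linear.

(** One generator v with relations w_l: the image of [row_comb] is the left ideal they generate,
    which is the annihilator of v. *)
Lemma cyclic_finitely_presented :
  (forall x : M, exists a : A, x = a *: v) ->
  (forall a : A, a *: v = 0 <-> exists r : 'I_m -> A, a = \sum_l r l * w l) ->
  finitely_presented M.
Proof.
move=> v_gen v_rel; exists m, 1, row_comb, row_act; split.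
  apply/seteqP; split=> [_ [r _ <-]|r /v_rel[s sE]].
    by apply/v_rel; exists (r 0); rewrite mxE.
  exists (\row_l s l) => //; apply/rowP => i; rewrite (ord1 i) mxE sE.
  by apply: eq_bigr => l _; rewrite mxE.
apply/seteqP; split=> // x _; have [a ->] := v_gen x.
by exists (\row__ a) => //=; rewrite /row_act mxE.
Qed.
End FinitePresentation.

(** * Sets of numbers prescribed by base p digits *)

Lemma count_iotaS (Q : pred nat) k :
  count Q (iota 0 k.+1) = (count Q (iota 0 k) + Q k)%N.
Proof. by rewrite -addn1 iotaD count_cat /= addn0. Qed.

Section DigitSet.
Variables (p : nat) (S : pred nat).
Hypothesis p_gt1 : (1 < p)%N.

Fixpoint digit_seq k : seq nat :=
  if k is k'.+1 then
    if S k' then [seq (c * p ^ k' + b)%N | c <- iota 0 p, b <- digit_seq k']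
    else digit_seq k'
  else [:: 0%N].

(** Since b < p^b, the first b positions carry all the digits of b. *)
Definition digit_set : pred nat := fun b => b \in digit_seq b.

Let expp_gt0 k : (0 < p ^ k)%N. Proof. by rewrite expn_gt0 ltnW. Qed.

Lemma digit_seq_lt k b : b \in digit_seq k -> (b < p ^ k)%N.
Proof.
elim: k b => [|k IH] b /=; first by rewrite inE => /eqP ->.
have kk : (p ^ k <= p ^ k.+1)%N by rewrite leq_pexp2l // ltnW.
case: ifP => _ => [/allpairsP[[c b'] /= [cp /IH b'k ->]]|/IH bk].
  rewrite mem_iota in cp; rewrite expnS.
  by apply: (@leq_trans (c.+1 * p ^ k)); [rewrite mulSn addnC; lia|nia].
exact: leq_trans bk kk.
Qed.

Lemma digit_seqS k b : (b < p ^ k)%N ->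
  (b \in digit_seq k.+1) = (b \in digit_seq k).
Proof.
move=> bk /=; case: ifP => // _; apply/allpairsP/idP => [[[c b'] /= []]|bd].
  move=> _ b'd bE; move: bk; rewrite bE; case: c {bE} => [//|c].
  by rewrite mulSn; lia.
by exists (0%N, b); split=> //=; rewrite mem_iota /= add0n ltnW.
Qed.

Lemma digit_seq_leq k l b : (k <= l)%N -> (b < p ^ k)%N ->
  (b \in digit_seq l) = (b \in digit_seq k).
Proof.
move=> /subnK <-; elim: (l - k)%N => // d IH bk; rewrite addSn digit_seqS ?IH //.
by apply: leq_trans bk _; rewrite leq_pexp2l ?leq_addl // ltnW.
Qed.

Lemma digit_setE k b : (b < p ^ k)%N -> digit_set b = (b \in digit_seq k).
Proof.
move=> bk; rewrite /digit_set; have bb : (b < p ^ b)%N by exact: ltn_expl.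
have [kb|/ltnW bk'] := leqP k b; first exact: digit_seq_leq.
by rewrite (digit_seq_leq bk' bb).
Qed.

Lemma digit_seq_uniq k : uniq (digit_seq k).
Proof.
elim: k => //= k IH; case: ifP => // _.
apply: allpairs_uniq => //; first exact: iota_uniq.
move=> x y /allpairsP[[c b] /= [_ /digit_seq_lt bk ->]].
move=> /allpairsP[[c' b'] /= [_ /digit_seq_lt bk' ->]] /= e.
have := congr1 (fun x => x %/ p ^ k)%N e; rewrite !divnMDl // !divn_small // !addn0.
by move=> cc; move: e; rewrite cc => /addnI ->.
Qed.

Lemma size_digit_seq k : size (digit_seq k) = (p ^ count S (iota 0 k))%N.
Proof.
elim: k => // k IH; rewrite count_iotaS expnD -IH /=.
by case: (S k); rewrite ?muln1 // size_allpairs size_iota mulnC.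
Qed.

Lemma count_digit_set k :
  count digit_set (iota 0 (p ^ k)) = (p ^ count S (iota 0 k))%N.
Proof.
rewrite -size_digit_seq -size_filter; apply/perm_size/uniq_perm.
- by rewrite filter_uniq // iota_uniq.
- exact: digit_seq_uniq.
move=> b; rewrite mem_filter mem_iota add0n /=.
have [bk|kb] := ltnP b (p ^ k); first by rewrite andbT (digit_setE bk).
by rewrite andbF; apply/esym/negP => /digit_seq_lt; rewrite ltnNge kb.
Qed.

(** A consequence of Lucas' theorem: if C(a, b) is nonzero mod p, each digit of b is at most that of
    a. Here [bin_expn_charD] strips p^k off a until its leading digit is gone. *)
Lemma digit_set_bin (K : fieldType) a b : p \in [pchar K] ->
  digit_set a -> 'C(a, b)%:R != 0 :> K -> digit_set b.
Proof.
move=> charKp aT abK; have ba : (b <= a)%N.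
  by rewrite leqNgt; apply: contraNN abK => /bin_small ->.
have aa : (a < p ^ a)%N by exact: ltn_expl.
rewrite (digit_setE (leq_ltn_trans ba aa)); move: aT; rewrite /digit_set.
move: {2 3}a => k {ba aa}; move: abK.
elim: k a b => [|k IH] a b abK /=.
  rewrite !inE => /eqP a0; move: abK; rewrite a0 bin0n.
  by case: (b == 0%N) => //; rewrite eqxx.
case: ifP => // [_|_ ad]; last exact: IH abK ad.
case/allpairsP => -[c a0] /= [cp a0d aE].
suff [c' [b0 [c'c b0d ->]]] : exists c' b0,
    [/\ (c' <= c)%N, b0 \in digit_seq k & b = (c' * p ^ k + b0)%N].
  apply/allpairsP; exists (c', b0); split=> //=.
  by move: cp; rewrite !mem_iota; lia.
rewrite aE in abK; elim: c b abK {cp aE} => [|c IHc] b.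
  by move=> /IH/(_ a0d) bd; exists 0%N, b.
rewrite mulSn -addnA (bin_expn_charD charKp) => abK.
(* One of the two summands is nonzero; the second one accounts for one more p^k in b. *)
have [/IHc[c' [b0 [c'c b0d ->]]]|] := boolP ('C(c * p ^ k + a0, b)%:R != 0 :> K).
  by exists c', b0; rewrite leqW.
move/negPn/eqP => e0; move: abK; rewrite e0 add0r.
case: leqP => [kb /IHc[c' [b0 [c'c b0d bE]]]|]; last by rewrite eqxx.
by exists c'.+1, b0; rewrite mulSn -addnA -bE subnKC.
Qed.
End DigitSet.

(** * Digit positions of density t *)

Section BeattyDigits.
Variables (R : realType) (t : R).
Hypotheses (t_ge0 : 0 <= t) (t_le1 : t <= 1).

Definition beatty_set : pred nat :=
  fun k => Num.trunc (t * k.+1%:R) != Num.trunc (t * k%:R).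

(** As t <= 1, floor(t k) increases by at most one at each step, so counting its jumps
    telescopes. *)
Lemma count_beatty_set k : count beatty_set (iota 0 k) = Num.trunc (t * k%:R).
Proof.
elim: k => [|k IH]; first by rewrite mulr0 truncn0.
rewrite count_iotaS IH /beatty_set.
have tk0 j : 0 <= t * j%:R by rewrite mulr_ge0.
have := truncn_itv (tk0 k); have := truncn_itv (tk0 k.+1).
set x := Num.trunc _; set y := Num.trunc _ => /andP[x1 x2] /andP[y1 y2].
rewrite -[k.+1%:R]natr1 mulrDr mulr1 in x1 x2.
move: (t * k%:R) x1 x2 y1 y2 => z x1 x2 y1 y2.
have : (y < x.+1)%N.
  by rewrite -(ltr_nat R); apply/(le_lt_trans y1)/(le_lt_trans _ x2); rewrite lerDl.
have : (x < y.+2)%N.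
  rewrite -(ltr_nat R) -[y.+2%:R]natr1; apply: le_lt_trans x1 _; exact: ltr_leD.
by case: eqP => //=; lia.
Qed.

(** The count is p^floor(t k), and t k - 1 < floor(t k) <= t k. *)
Lemma beatty_digit_bounds p k : (1 < p)%N ->
  let tau := count (digit_set p beatty_set) (iota 0 (p ^ k)) in
  p%:R^-1 * (p ^ k)%N%:R `^ t <= tau%:R <= (p ^ k)%N%:R `^ t.
Proof.
move=> p1 /=; rewrite count_digit_set // count_beatty_set.
have p0 : 0 < p%:R :> R by rewrite ltr0n ltnW.
have p1R : 1 <= p%:R :> R by rewrite ler1n ltnW.
rewrite !natrX -!powR_mulrn // -powRrM [k%:R * t]mulrC.
have tk0 : 0 <= t * k%:R by rewrite mulr_ge0.
have /andP[x1 x2] := truncn_itv tk0; apply/andP; split; last exact: ler_powR.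
rewrite -[X in X^-1 * _]powRr1 ?ler0n // -powRN -powRD; last first.
  by rewrite (gt_eqF p0) implybT.
by apply: ler_powR => //; move: x2; rewrite -natr1; lra.
Qed.
End BeattyDigits.

(** * Cyclic modules of real dimension *)

Section CyclicModule.
Variables (R : realType) (K : fieldType) (n p : nat).
Hypotheses (charKp : p \in [pchar K]) (n_gt0 : (0 < n)%N).
Local Notation D := (diffop K n).
Variable t : R.
Hypotheses (t_ge0 : 0 <= t) (t_le1 : t <= 1).

Let T := digit_set p (beatty_set t).

Lemma cyclic_module_dim : exists M : lmodType D,
  cyclic_module M /\ Dim R M = (n%:R + t *+ n)%:E.
Proof.
have p_gt1 := prime_gt1 (pcharf_prime charKp).
have T0 : T 0 by rewrite /T /digit_set inE.
pose I (u : D) := forall a : 'X_{1..n}, (forall l, T (a l)) -> u 'X_[a] = 0.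
have [||a u Iu m Tm|M [v [v_gen vI]]] := @cyclic_quotient D I.
- by move=> a _.
- move=> u w Iu Iw a Ta.
  by rewrite diffop_addE -[- w]scaleN1r diffop_scaleE Iu // Iw // scaler0 addr0.
- by rewrite diffop_mulE Iu // linear0.
have v_red (a b : 'X_{1..n}) : exists (c : K) a' b',
    [/\ good_exp predT T a' b', (mdeg a' + mdeg b' <= mdeg a + mdeg b)%N &
      (mulop 'X_[a] * dpowm K b) *: v =
      c%:A *: ((mulop 'X_[a'] * dpowm K b') *: v)].
  have [/forallP Tb|/forallPn[l Tl]] := boolP [forall l, T (b l)].
    exists 1, a, b; split=> //; first by apply/forallP => l; rewrite Tb.
    by rewrite !scale1r.
  (* Even with coefficient 0 the exponents must be good; zero exponents are, as 0 lies in [T]. *)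
  exists 0, 0%MM, 0%MM; split; first by apply/forallP => i; rewrite !mnm0E.
    by rewrite mdeg0.
  rewrite !scale0r; apply/vI => m Tm.
  rewrite diffop_mulE dpowm_X; suff -> : (binm m b)%:R = 0 :> K.
    by rewrite scale0r linear0.
  apply/eqP; rewrite natr_prod prodf_seq_eq0; apply/hasP; exists l => /=.
    exact: mem_index_enum.
  by apply: contraNT Tl; apply: digit_set_bin (Tm l).
have v_free : forall s, kfree (@good_family K n predT T M v s).
  apply: (good_family_free charKp) => u /vI Iu; exists 0 => k b e _ Tb _.
  (* Every variable belongs to [E], so the test monomial is x^b itself, which [u] kills. *)
  suff -> : test_exp p predT k b = b by rewrite Iu // mcoeff0.
  by apply/mnmP => l; rewrite mnmE.
exists M; split; first by exists v.
have p0 : 0 < p%:R :> R by rewrite ltr0n ltnW.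
(* The cube count is s^n tau(s)^n with tau(s) <= p^t s^t, and tau(s) >= p^-1 s^t at powers of p;
   hence the two constants. *)
apply: (@Dim_eq K n predT T M v v_gen v_red v_free R _
  ((p%:R `^ t) ^+ n) (p%:R ^- n) p) => //.
- by rewrite ltr_pwDl ?ltr0n // mulrn_wge0.
- by rewrite invr_gt0 exprn_gt0.
- move=> s s0; rewrite card_good_box // count_predT size_iota natrM !natrX.
  have sR0 : s%:R != 0 :> R by rewrite pnatr_eq0 -lt0n.
  rewrite powRD ?sR0 ?implybT // powR_mulrn // -[t *+ n]mulr_natr powRrM.
  rewrite powR_mulrn ?powR_ge0 // mulrCA -[_ `^ t ^+ n * _]exprMn.
  rewrite ler_pM2l ?exprn_gt0 ?ltr0n //.
  rewrite lerXn2r ?nnegrE //.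
  (* Rounding s up to the next power of p costs the factor p^t. *)
  have /andP[ps sp] := trunc_log_bounds p_gt1 s0; set k := trunc_log p s in ps sp.
  have /andP[_ +] := beatty_digit_bounds t_ge0 t_le1 k.+1 p_gt1.
  move=> tau_le; apply: (@le_trans _ _ ((p ^ k.+1)%N%:R `^ t)).
    apply: le_trans tau_le; rewrite ler_nat.
    by rewrite -[(p ^ k.+1)%N](subnKC (ltnW sp)) iotaD count_cat leq_addr.
  rewrite -powRM ?ler0n // ge0_ler_powR ?nnegrE ?mulr_ge0 //.
  by rewrite -natrM ler_nat expnS leq_mul2l ps orbT.
move=> k; have q0 : (0 < p ^ k)%N by rewrite expn_gt0 ltnW.
have qR0 : (p ^ k)%N%:R != 0 :> R by rewrite pnatr_eq0 -lt0n.
rewrite card_good_box // count_predT size_iota natrM.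
rewrite [((p ^ k) ^ n)%N%:R]natrX [(count _ _ ^ n)%N%:R]natrX.
rewrite powRD ?qR0 ?implybT // powR_mulrn // -[t *+ n]mulr_natr powRrM.
rewrite powR_mulrn ?powR_ge0 // mulrCA -exprVn -[_^-1 ^+ n * _]exprMn.
rewrite ler_pM2l ?exprn_gt0 ?ltr0n // lerXn2r ?nnegrE ?mulr_ge0 ?powR_ge0 //.
by have /andP[] := beatty_digit_bounds t_ge0 t_le1 k p_gt1.
Qed.
End CyclicModule.

(** * Finitely presented modules of integer dimension *)

Section FinitelyPresentedModule.
Variables (R : realType) (K : fieldType) (n p : nat).
Hypotheses (charKp : p \in [pchar K]) (n_gt0 : (0 < n)%N).
Local Notation D := (diffop K n).

Lemma mcoeff_mulX (f : {mpoly K[n]}) (a e : 'X_{1..n}) l :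
  (e l < a l)%N -> ('X_[a] * f)@_e = 0.
Proof.
move=> ea; elim/mpolyind: f => [|c m f _ _ IH]; first by rewrite mulr0 mcoeff0.
rewrite mulrDr mcoeffD IH addr0 -scalerAr -mpolyXD mcoeffZ mcoeffX.
case: eqP => [e'|_]; last by rewrite mulr0.
by move: ea; rewrite -e' mnmDE ltnNge leq_addr.
Qed.

(** For b < q = p^k, C(q + m, b) = C(m, b) in K, so d^[b] does not notice the factor x_l^q. *)
Lemma canon_filt_comm_Xexpn N k l (u : D) : (N < p ^ k)%N -> canon_filt N u ->
  u * mulop 'X_[U_(l) *+ p ^ k] = mulop 'X_[U_(l) *+ p ^ k] * u.
Proof.
move=> Nk; move: u; apply: canon_filt_ind => [|c u w uC wC|a b ab].
- by rewrite mulr0 mul0r.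
- by rewrite mulrDl mulrDr -scalerAl -scalerAr uC wC.
have bC : dpowm K b * mulop 'X_[U_(l) *+ p ^ k] =
    mulop 'X_[U_(l) *+ p ^ k] * dpowm K b.
  apply: diffop_eqX => m; rewrite !diffop_mulE !mulopE -mpolyXD !dpowm_X.
  have -> : (binm (U_(l) *+ p ^ k + m) b)%:R = (binm m b)%:R :> K.
    rewrite !natr_prod; apply: eq_bigr => i _; rewrite mnmDE mulmnE mnm1E.
    case: eqP => [<-|_]; last by rewrite mul0n.
    rewrite mul1n (bin_expn_charD charKp) leqNgt (_ : (b l < p ^ k)%N) ?addr0 //.
    have := mnm_lt_mdeg l (leq_trans (leq_addl (mdeg a) (mdeg b)) ab).
    by rewrite ltnS => /leq_ltn_trans; exact.
  rewrite -scalerAr -mpolyXD.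
  have [->|] := eqVneq (binm m b) 0%N; first by rewrite !scale0r.
  by rewrite binm_neq0 => bm; rewrite addmBA.
rewrite -mulrA bC !mulrA -!mulopM -!mpolyXD; congr (mulop 'X_[_] * _).
exact: addmC.
Qed.

Variable j : nat.
Hypothesis jn : (j <= n)%N.

(** Padding with zeros lets all the variables index the generators. *)
Let w (l : 'I_n) : D := if (l < j)%N then mulop 'X_l else 0.

Lemma fp_module_dim : exists M : lmodType D,
  [/\ finitely_presented M, exists x : M, x <> 0 &
      Dim R M = (2 * n - j)%:R%:E].
Proof.
have p_gt1 := prime_gt1 (pcharf_prime charKp).
have expp_gt0 k : (0 < p ^ k)%N by rewrite expn_gt0 ltnW.
pose I (u : D) := exists r : 'I_n -> D, u = \sum_l r l * w l.
have [|u u' [r ->] [r' ->]|a u [r ->]|M [v [v_gen vI]]] := @cyclic_quotient D I.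
- by exists (fun=> 0); rewrite big1 // => l _; rewrite mul0r.
- exists (fun l => r l - r' l); rewrite -sumrB; apply: eq_bigr => l _.
  by rewrite mulrBl.
- by exists (fun l => a * r l); rewrite mulr_sumr; apply: eq_bigr => l _; rewrite mulrA.
pose E : pred nat := leq j.
have v_X (u : D) (l : 'I_n) : (l < j)%N -> (u * mulop 'X_l) *: v = 0.
  move=> lj; apply/vI; exists (fun i => if i == l then u else 0).
  rewrite (bigD1 l) //= eqxx /w lj big1 ?addr0 // => i /negPf ->.
  by rewrite mul0r.
have v_red (a b : 'X_{1..n}) : exists (c : K) a' b',
    [/\ good_exp E predT a' b', (mdeg a' + mdeg b' <= mdeg a + mdeg b)%N &
      (mulop 'X_[a] * dpowm K b) *: v =
      c%:A *: ((mulop 'X_[a'] * dpowm K b') *: v)].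
  (* An x_l with l < j is carried across d^[b] to v, which it kills; only the commutator term
     remains, of lower degree in x. *)
  have [d] := ubnP (mdeg a); elim: d a b => // d IH a b ad.
  have [gab|/forallPn[l]] := boolP (good_exp E predT a b).
    by exists 1, a, b; rewrite !scale1r.
  rewrite andbT negb_or -ltnNge => /andP[lj al].
  have aE : a = (a - U_(l) + U_(l))%MM by rewrite submK // lep1mP.
  set a' := (a - U_(l))%MM in aE.
  have xE : (mulop 'X_[a] * dpowm K b) *: v =
      - ((mulop 'X_[a'] * (if (0 < b l)%N then dpowm K (b - U_(l)) else 0)) *: v).
    rewrite aE mpolyXD mulopM -mulrA.
    have -> : mulop 'X_l * dpowm K b = dpowm K b * mulop 'X_l -
        (if (0 < b l)%N then dpowm K (b - U_(l))%MM else 0).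
      by rewrite dpowm_comm addrK.
    by rewrite mulrBr scalerBl mulrA v_X // sub0r.
  have ad' : (mdeg a' < mdeg a)%N by rewrite aE mdegD mdeg1 addn1.
  have [c [a1 [b1 [g1 m1 e1]]]] := IH a' (b - U_(l))%MM (leq_trans ad' ad).
  exists (if (0 < b l)%N then - c else 0), a1, b1; split=> //.
    by apply: leq_trans m1 _; apply: leq_add; [exact: ltnW|exact: mdegB].
  rewrite xE; case: ifP => _; last by rewrite mulr0 !scale0r oppr0.
  by rewrite e1 !scaleNr.
have ann (u : D) : u *: v = 0 -> exists k0, forall k (b e : 'X_{1..n}),
    (k0 <= k)%N -> (forall l, predT (b l)) ->
    (forall l : 'I_n, ~~ E l -> (e l < p ^ k)%N) ->
    (u 'X_[test_exp p E k b])@_e = 0.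
  move=> /vI[r ->]; have [N FN] := canon_filt_uniform r.
  exists N => k b e Nk _ eq; set m := test_exp _ _ _ _.
  rewrite diffop_sumE raddf_sum big1 // => l _; rewrite diffop_mulE /w.
  case: ifP => lj; last by rewrite linear0 raddf0.
  have El : ~~ E l by rewrite -ltnNge.
  rewrite mulopE -mpolyXD.
  (* The factor x_l completes x_l^(p^k - 1) to x_l^(p^k), which commutes with r_l as N < p^k and
     thus divides the result. *)
  have -> : (U_(l) + m = U_(l) *+ p ^ k + (m - U_(l) *+ (p ^ k).-1))%MM.
    apply/mnmP => i; rewrite !(mnmDE, mnmBE, mulmnE, mnm1E).
    case: eqP => [<-|_]; last by rewrite !mul0n subn0.
    by rewrite mnmE (negPf El) !mul1n subnn addn0 add1n prednK.
  rewrite mpolyXD -[X in r l X]/(mulop _ _) -diffop_mulE.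
  rewrite (canon_filt_comm_Xexpn (N := N)) //; last first.
    exact: leq_ltn_trans Nk (ltn_expl k p_gt1).
  rewrite diffop_mulE mulopE; apply: (@mcoeff_mulX _ _ _ l).
  by rewrite mulmnE mnm1E eqxx mul1n eq.
exists M; split.
- exact: (@cyclic_finitely_presented _ _ v n w).
(* If v were 0, then 1 would annihilate it, yet 1 fixes the test monomial. *)
- exists v => v0; have [|k0 u0] := ann 1; first by rewrite scale1r.
  pose m := test_exp p E k0 (0%MM : 'X_{1..n}).
  have : ((1 : D) 'X_[m])@_m = 0.
    by apply: u0 => // l El; rewrite mnmE (negPf El) prednK.
  by rewrite -mulop1 mulopE mul1r mcoeffX eqxx => /eqP; rewrite oner_eq0.
have boxE s : (0 < s)%N -> #|@good_box n E predT s| = (s ^ (2 * n - j))%N.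
  move=> s0; rewrite card_good_box // count_predT size_iota.
  rewrite -[in iota 0 n](subnKC jn) iotaD count_cat.
  rewrite (@eq_in_count _ E pred0 (iota 0 j)) => [|l]; last first.
    by rewrite mem_iota add0n /E /= => lj; rewrite leqNgt lj.
  rewrite (@eq_in_count _ E predT (iota _ (n - j))) => [|l]; last first.
    by rewrite mem_iota /E /= => /andP[-> _].
  rewrite count_pred0 count_predT size_iota add0n -expnD; congr (_ ^ _)%N; lia.
have box1 s : (0 < s)%N -> #|@good_box n E predT s|%:R = s%:R `^ (2 * n - j)%:R :> R.
  by move=> s0; rewrite boxE // natrX powR_mulrn.
apply: (@Dim_eq K n E predT M v v_gen v_red (good_family_free charKp ann) R _
  1 1 p) => //; first by rewrite ltr0n; lia.
  by move=> s s0; rewrite box1 // mul1r.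
by move=> k; rewrite box1 // mul1r.
Qed.
End FinitelyPresentedModule.

Theorem theorem1p5 (R : realType) (K : fieldType) (p n : nat)
    (charKp : p \in [pchar K]) (n_gt0 : (0 < n)%N) :
  (forall d : R, n%:R <= d <= (2 * n)%:R ->
     exists M : lmodType (diffop K n),
       cyclic_module M /\ Dim R M = d%:E) /\
  (forall d : nat, (n <= d <= 2 * n)%N ->
     exists N : lmodType (diffop K n),
       [/\ finitely_presented N, exists x : N, x <> 0 & Dim R N = d%:R%:E]).
Proof.
split=> d /andP[nd dn].
  have n0 : 0 < n%:R :> R by rewrite ltr0n.
  (* With t = d/n - 1, n + t n = d and t lies in [0, 1]. *)
  have := @cyclic_module_dim R K n p charKp n_gt0 (d / n%:R - 1).
  rewrite subr_ge0 ler_pdivlMr // mul1r lerBlDr ler_pdivrMr // -[(_ - _) *+ n]mulr_natr.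
  rewrite mulrBl divfK ?gt_eqF // mul1r subrKC => /(_ nd); apply.
  by move: dn; rewrite natrM.
(* The number j = 2n - d of variables killing v is at most n because n <= d. *)
have := @fp_module_dim R K n p charKp n_gt0 (2 * n - d); rewrite subKn //.
by apply; lia.
Qed.
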